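(* Let $G$ be a finite group, let $R$ be a Green functor for $G$, and let $Q\subseteq\mathbb{Q}$ be a subring containing $|G|^{-1}$. Let $R_Q$ denote the Green functor obtained by tensoring $R$ with $Q$. Then the Brauer quotient functor $$\mathrm{Br}^R\colon R\text{-}\mathsf{Mack}(G)\longrightarrow \prod_{\mathrm{Cl}(H),\,H\le G}\overline{R}(H)\rtimes_c W_G(H)\text{-}\mathsf{Mod},\qquad M\mapsto(\overline{M}(H),c)_{\mathrm{Cl}(H)},$$ induces (by restriction to $Q$-local objects on both sides) an equivalence of categories $$R_Q\text{-}\mathsf{Mack}(G)\;\simeq\;\prod_{\mathrm{Cl}(H),\,H\le G} Q\otimes_{\mathbb{Z}}\overline{R}(H)\rtimes_c W_G(H)\text{-}\mathsf{Mod}.$$ The products run over the $G$-conjugacy classes $\mathrm{Cl}(H)$ of subgroups $H\leq G$ (one representative $H$ chosen in each class).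
   Context: Notation: ${}^gH=gHg^{-1}$, $H^g=g^{-1}Hg$, $W_G(H)=N_G(H)/H$. Mackey functors. A Mackey functor $M$ for $G$ consists of an abelian group $M(H)$ for each subgroup $H\le G$ and homomorphisms $\mathrm{res}^H_K\colon M(H)\to M(K)$, $\mathrm{ind}^H_K\colon M(K)\to M(H)$, $c_g=c_{g,H}\colon M(H)\to M({}^gH)$ for all $K\le H\le G$, $g\in G$, satisfying the usual axioms: $\mathrm{res}$ and $\mathrm{ind}$ are transitive with $\mathrm{res}^H_H=\mathrm{ind}^H_H=\mathrm{id}$; $c_gc_{g'}=c_{gg'}$; $c_{h,H}=\mathrm{id}$ for $h\in H$; $c_g\,\mathrm{res}^H_K=\mathrm{res}^{{}^gH}_{{}^gK}c_g$ and $c_g\,\mathrm{ind}^H_K=\mathrm{ind}^{{}^gH}_{{}^gK}c_g$; and the Mackey formula $\mathrm{res}^H_L\mathrm{ind}^H_K=\sum_{x\in L\backslash H/K}\mathrm{ind}^L_{L\cap{}^xK}\,c_x\,\mathrm{res}^K_{L^x\cap K}$ for $K,L\le H$. Morphisms are families of homomorphisms commuting with all these maps. Green functors and modules. A Green functor $R$ is a Mackey functor such that each $R(H)$ is an associative unital ring, restrictions and conjugations are ring maps, and $\mathrm{ind}^H_K(\mathrm{res}^H_K(r)\,r')=r\,\mathrm{ind}^H_K(r')$, $\mathrm{ind}^H_K(r\,\mathrm{res}^H_K(r'))=\mathrm{ind}^H_K(r)\,r'$. A (left) Mackey $R$-module is a Mackey functor $M$ with each $M(H)$ a left $R(H)$-module,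 such that $\mathrm{res}(rm)=\mathrm{res}(r)\mathrm{res}(m)$, $c_g(rm)=c_g(r)c_g(m)$, $\mathrm{ind}^H_K(\mathrm{res}^H_K(r)m)=r\,\mathrm{ind}^H_K(m)$, $\mathrm{ind}^H_K(r\,\mathrm{res}^H_K(m))=\mathrm{ind}^H_K(r)m$. These form the abelian category $R\text{-}\mathsf{Mack}(G)$, whose morphisms are the morphisms of Mackey functors with $R(H)$-linear components. Rationalization. $R_Q(H):=Q\otimes_{\mathbb{Z}}R(H)$ with the induced structure maps. $R_Q\text{-}\mathsf{Mack}(G)$ is identified with the full subcategory of $R\text{-}\mathsf{Mack}(G)$ of $Q$-local modules, i.e. those taking values in $Q$-modules. Skew group rings. If a finite group $W$ acts on a ring $S$ by ring automorphisms $\alpha_w$, then $S\rtimes_\alpha W$ is the free $S$-module $\bigoplus_{w\in W}Sw$ with multiplication $(sw)(s'w')=(s\,\alpha_w(s'))(ww')$. A left module over it is the same as a pair $(V,\varphi)$ of a left $S$-module $V$ and a $W$-action $\varphi$ on the abelian group $V$ with $\varphi_w(sv)=\alpha_w(s)\varphi_w(v)$; morphisms are $S$-linear $W$-equivariant maps. The expression $Q\otimes_{\mathbb Z}S\rtimes_\alpha W$ means $Q\otimes_{\mathbb Z}(S\rtimes_\alpha W)\cong(Q\otimes_{\mathbb Z}S)\rtimes W$; its modules are identified with the $Q$-local $S\rtimes_\alpha W$-modules. Brauer quotients. For a Mackey functor $M$ and $H\le G$, $\overline{M}(H):=M(H)/\sum_{H'\lneq H}\mathrm{ind}_{H'}^H(M(H'))$.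 The conjugation maps $c_g$, $g\in N_G(H)$, induce a $W_G(H)$-action $c$ on $M(H)$ and on $\overline{M}(H)$. For a Green functor $R$, $\overline{R}(H)$ is a quotient ring of $R(H)$ on which $W_G(H)$ acts by ring automorphisms via $c$. For a Mackey $R$-module $M$, $\overline{M}(H)$ with its induced $\overline{R}(H)$-action and conjugation action $c$ is a left $\overline{R}(H)\rtimes_cW_G(H)$-module. On morphisms, $\mathrm{Br}^R$ sends $f$ to the family of induced maps $\overline{f_H}\colon\overline{M}(H)\to\overline{M'}(H)$. *)

(* Defs.v *)
From HB Require Import structures.
#[warnings="-notation-overridden,-ambiguous-paths"]
From mathcomp Require Import all_boot all_fingroup all_algebra.
From mathcomp Require Import boolp.

Set Implicit Arguments.
Unset Strict Implicit.
Unset Printing Implicit Defensive.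

Import GRing.Theory.

Local Open Scope ring_scope.
Local Open Scope quotient_scope.

Local Notation qrepr := generic_quotient.repr.

Record category := Category {
  obj :> Type;
  hom : obj -> obj -> Type;
  idm : forall X : obj, hom X X;
  comp : forall X Y Z : obj, hom Y Z -> hom X Y -> hom X Z;
  comp1m : forall (X Y : obj) (f : hom X Y), comp (idm Y) f = f;
  compm1 : forall (X Y : obj) (f : hom X Y), comp f (idm X) = f;
  compA : forall (X Y Z T : obj) (h : hom Z T) (g : hom Y Z) (f : hom X Y),
    comp h (comp g f) = comp (comp h g) f }.

Arguments hom {c} X Y.
Arguments idm {c} X.
Arguments comp {c X Y Z} g f.

Definition is_iso (C : category) (X Y : C) (f : hom X Y) : Prop :=
  exists g : hom Y X, comp g f = idm X /\ comp f g = idm Y.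

Record functor (C D : category) := Functor {
  fobj :> C -> D;
  fmap : forall X Y : C, hom X Y -> hom (fobj X) (fobj Y);
  fmap1 : forall X : C, fmap (idm X) = idm (fobj X);
  fmapM : forall (X Y Z : C) (g : hom Y Z) (f : hom X Y),
    fmap (comp g f) = comp (fmap g) (fmap f) }.

Arguments fmap {C D} _ {X Y} _.

Section Functors.
Variables C D E : category.

Definition idF : functor C C.
Proof. exact: (@Functor C C id (fun X Y f => f)). Defined.

Definition compF (G : functor D E) (F : functor C D) : functor C E.
Proof.
refine (@Functor C E (fun X => G (F X)) (fun X Y f => fmap G (fmap F f)) _ _).
  by move=> X; rewrite !fmap1.
by move=> X Y Z g f; rewrite !fmapM.
Defined.

End Functors.

Arguments idF C : clear implicits.

Definition nat_iso (C D : category) (F G : functor C D) : Prop :=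
  exists t : forall X : C, hom (F X) (G X),
    (forall (X Y : C) (f : hom X Y),
       comp (t Y) (fmap F f) = comp (fmap G f) (t X)) /\
    (forall X : C, is_iso (t X)).

Definition is_equivalence (C D : category) (F : functor C D) : Prop :=
  exists G : functor D C,
    nat_iso (compF G F) (idF C) /\ nat_iso (compF F G) (idF D).

Definition full_sub (C : category) (P : C -> Prop) : category.
Proof.
refine (@Category {X : C | P X} (fun X Y => hom (sval X) (sval Y))
  (fun X => idm (sval X)) (fun X Y Z g f => comp g f) _ _ _).
- by move=> X Y f; exact: comp1m.
- by move=> X Y f; exact: compm1.
- by move=> X Y Z T h g f; exact: compA.
Defined.

Definition restrictF (C D : category) (F : functor C D)
  (P : C -> Prop) (P' : D -> Prop) (FP : forall X, P X -> P' (F X)) :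
  functor (full_sub P) (full_sub P').
Proof.
refine (@Functor (full_sub P) (full_sub P')
  (fun X => exist P' (F (sval X)) (FP (sval X) (svalP X)))
  (fun X Y f => fmap F (f : hom (sval X) (sval Y))) _ _).
- by move=> X; exact: fmap1.
- by move=> X Y Z g f; exact: fmapM.
Defined.

Definition prod_cat (I : Type) (D : I -> category) : category.
Proof.
refine (@Category (forall i, D i) (fun X Y => forall i, hom (X i) (Y i))
  (fun X i => idm (X i)) (fun X Y Z g f i => comp (g i) (f i)) _ _ _).
- by move=> X Y f; apply: functional_extensionality_dep => i; exact: comp1m.
- by move=> X Y f; apply: functional_extensionality_dep => i; exact: compm1.
- by move=> X Y Z T h g f; apply: functional_extensionality_dep => i;
    exact: compA.
Defined.

Definition pairF (C : category) (I : Type) (D : I -> category)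
  (F : forall i, functor C (D i)) : functor C (prod_cat D).
Proof.
refine (@Functor C (prod_cat D) (fun X i => F i X) (fun X Y f i => fmap (F i) f)
  _ _).
- by move=> X; apply: functional_extensionality_dep => i; exact: fmap1.
- by move=> X Y Z g f; apply: functional_extensionality_dep => i; exact: fmapM.
Defined.

Section ModCat.
Variable A : pzRingType.

Record mod_hom (V W : lmodType A) := ModHom {
  mod_fun :> V -> W;
  mod_lin : linear mod_fun }.

Lemma mod_hom_eq (V W : lmodType A) (f g : mod_hom V W) : f =1 g -> f = g.
Proof.
case: f g => [f fl] [g gl] /= /funext e; case: _ / e gl => gl.
by congr ModHom; exact: Prop_irrelevance.
Qed.

Definition Mod : category.
Proof.
refine (@Category (lmodType A) mod_hom
  (fun V => @ModHom V V id (fun a u v => erefl))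
  (fun U V W g f => @ModHom U W (fun x => g (f x)) _) _ _ _).
- by move=> X Y f; exact: mod_hom_eq.
- by move=> X Y f; exact: mod_hom_eq.
- by move=> X Y Z T h g f; exact: mod_hom_eq.
Unshelve. by move=> a u v; rewrite /= !mod_lin.
Defined.

End ModCat.

(** [Qact Q act]: [act] is a [Q]-module structure on the abelian group [V];
    only the values [act q] for [q \in Q] matter. *)
Definition Qact (Q : subringClosed rat) (V : zmodType) (act : rat -> V -> V) :=
  [/\ forall v, act 1 v = v,
      {in Q &, forall p q v, act (p * q) v = act p (act q v)},
      {in Q &, forall p q v, act (p + q) v = act p v + act q v} &
      {in Q, forall q, {morph act q : u v / u + v}}].

(** Since [Z -> Q] is an epimorphism of rings, a [Q]-module structure on [V] is
    unique, and additive maps preserve it, see [Qlocal_additive]. *)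
Definition Qlocal (Q : subringClosed rat) (V : zmodType) : Prop :=
  exists act : rat -> V -> V, Qact Q act.

(** [Q (x) A]-modules, as the Q-local [A]-modules. *)
Definition QMod (Q : subringClosed rat) (A : pzRingType) : category :=
  @full_sub (Mod A) (fun V : lmodType A => Qlocal Q V).

Lemma additive_pack (V V' : zmodType) (f : V -> V') :
  {morph f : u v / u + v} -> {g : {additive V -> V'} | g =1 f}.
Proof.
move=> fD; have fB : zmod_morphism f.
  by move=> a b; apply: (addIr (f b)); rewrite -fD !subrK.
pose F := GRing.isZmodMorphism.Build V V' f fB.
by exists (HB.pack f F : {additive V -> V'}).
Qed.

Lemma Qact_int (Q : subringClosed rat) (V : zmodType) (act : rat -> V -> V) :
  Qact Q act -> forall (n : int) v, act n%:~R v = v *~ n.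
Proof.
case=> act1 _ actD _ n v.
have act0 : act 0 v = 0.
  by apply: (addIr (act 0 v)); rewrite -actD ?rpred0 // !add0r.
have actN q : q \in Q -> act (- q) v = - act q v.
  move=> Qq; apply: (addIr (act q v)).
  by rewrite -actD ?rpredN // !addNr.
have actn m : act m%:R v = v *+ m.
  elim: m => [|m IH]; first by rewrite act0.
  by rewrite !mulrS actD ?rpred1 ?rpred_nat // act1 IH.
case: n => m; first by rewrite -pmulrn actn.
by rewrite NegzE mulrNz actN ?rpred_int // mulrNz -!pmulrn actn.
Qed.

Lemma Qlocal_additive (Q : subringClosed rat) (V V' : zmodType)
    (act : rat -> V -> V) (act' : rat -> V' -> V') :
  Qact Q act -> Qact Q act' -> forall (f : {additive V -> V'}) (q : rat),
  q \in Q -> forall v, f (act q v) = act' q (f v).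
Proof.
move=> Qa Qa' f q Qq v; have [a1 aM _ _] := Qa; have [a1' aM' _ _] := Qa'.
have d0 : (denq q)%:~R != 0 :> rat by rewrite intr_eq0 denq_eq0.
have Qd : (denq q)%:~R^-1 \in Q.
  have [u [w uw]] : exists u w, u * numq q + w * denq q = 1.
    have [u [w e]] := Bezoutz (numq q) (denq q); exists u, w; rewrite [LHS]e.
    by apply/eqP; have := coprime_num_den q; rewrite /coprime /gcdz => /eqP ->.
  have -> : (denq q)%:~R^-1 = u%:~R * q + w%:~R :> rat.
    apply: (mulIf d0); rewrite mulVf // mulrDl -mulrA.
    by rewrite -{1}[q]divq_num_den divfK // -!intrM -intrD uw.
  by rewrite rpredD ?rpredM ?rpred_int.
have fd : f (act (denq q)%:~R^-1 v) = act' (denq q)%:~R^-1 (f v).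
  have {2}-> : v = act (denq q)%:~R (act (denq q)%:~R^-1 v).
    by rewrite -aM ?rpred_int // divff.
  rewrite (Qact_int Qa) raddfMz -(Qact_int Qa') -aM' ?rpred_int //.
  by rewrite mulVf // a1'.
rewrite -{1 2}[q]divq_num_den aM ?rpred_int // aM' ?rpred_int //.
by rewrite !(Qact_int Qa, Qact_int Qa') raddfMz fd.
Qed.

Section QuotMap.
Variables (V V' : zmodType) (U : zmodClosed V) (U' : zmodClosed V').

Definition quot_map (f : V -> V') (x : {ideal_quot U}) : {ideal_quot U'} :=
  \pi_({ideal_quot U'}) (f (qrepr x)).

Lemma quot_eqP (x y : V) :
  reflect (\pi_({ideal_quot U}) x = \pi_({ideal_quot U}) y) (x - y \in U).
Proof. by rewrite Quotient.idealrBE; apply: eqP. Qed.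

Lemma repr_quotB (x : V) : qrepr (\pi_({ideal_quot U}) x) - x \in U.
Proof. by apply/quot_eqP; rewrite reprK. Qed.

Lemma quot_mapE (f : {additive V -> V'}) :
  {in U, forall x, f x \in U'} ->
  forall x : V, quot_map f (\pi_({ideal_quot U}) x) = \pi_({ideal_quot U'}) (f x).
Proof.
move=> fU x; rewrite /quot_map; apply: (elimT (eqP)).
by rewrite -Quotient.idealrBE -raddfB fU ?repr_quotB.
Qed.

End QuotMap.

Section RingQuot.
Variables (A : pzRingType) (I : zmodClosed A).
Hypothesis IMl : forall a, {in I, forall u, a * u \in I}.
Hypothesis IMr : forall a, {in I, forall u, u * a \in I}.

#[using="IMl IMr"]
Definition ring_quot : Type := {ideal_quot I}.

Local Notation AI := ring_quot.

HB.instance Definition _ := GRing.Zmodule.copy AI {ideal_quot I}.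

Definition rq_pi (a : A) : AI := \pi_({ideal_quot I}) a.
Definition rq_repr (a : AI) : A := qrepr (a : {ideal_quot I}).
Definition rq_mul (a b : AI) : AI := rq_pi (rq_repr a * rq_repr b).

Lemma rq_reprK a : rq_pi (rq_repr a) = a. Proof. exact: reprK. Qed.

Lemma rq_eqP a b : reflect (rq_pi a = rq_pi b) (a - b \in I).
Proof. exact: quot_eqP. Qed.

Lemma rq_piD a b : rq_pi (a + b) = rq_pi a + rq_pi b.
Proof. exact: (raddfD (\pi_({ideal_quot I}))). Qed.

Lemma rq_repr_piB a : rq_repr (rq_pi a) - a \in I.
Proof. exact: repr_quotB. Qed.

Lemma rq_mulE a b : rq_mul (rq_pi a) (rq_pi b) = rq_pi (a * b).
Proof.
apply/rq_eqP; have Ia := rq_repr_piB a; have Ib := rq_repr_piB b.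
set a' := rq_repr _ in Ia *; set b' := rq_repr _ in Ib *.
have -> : a' * b' - a * b = (a' - a) * b' + a * (b' - b).
  by rewrite mulrBl mulrBr addrA subrK.
by apply: rpredD; [exact: IMr | exact: IMl].
Qed.

Lemma rq_mulA : associative rq_mul.
Proof.
move=> x y z; rewrite -[x]rq_reprK -[y]rq_reprK -[z]rq_reprK.
by rewrite !rq_mulE mulrA.
Qed.
Lemma rq_mul1 : left_id (rq_pi 1) rq_mul.
Proof. by move=> x; rewrite -[x]rq_reprK rq_mulE mul1r. Qed.
Lemma rq_mulr1 : right_id (rq_pi 1) rq_mul.
Proof. by move=> x; rewrite -[x]rq_reprK rq_mulE mulr1. Qed.
Lemma rq_mulDl : left_distributive rq_mul +%R.
Proof.
move=> x y z; rewrite -[x]rq_reprK -[y]rq_reprK -[z]rq_reprK.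
by rewrite !rq_mulE -!rq_piD rq_mulE mulrDl.
Qed.
Lemma rq_mulDr : right_distributive rq_mul +%R.
Proof.
move=> x y z; rewrite -[x]rq_reprK -[y]rq_reprK -[z]rq_reprK.
by rewrite !rq_mulE -!rq_piD rq_mulE mulrDr.
Qed.

HB.instance Definition _ := GRing.Zmodule_isPzRing.Build AI
  rq_mulA rq_mul1 rq_mulr1 rq_mulDl rq_mulDr.

Lemma rq_piM a b : rq_pi (a * b) = rq_pi a * rq_pi b.
Proof. by rewrite -rq_mulE. Qed.

Variables (V : lmodType A) (U : zmodClosed V).
Hypothesis UZ : forall a, {in U, forall u, a *: u \in U}.
Hypothesis IZ : {in I, forall a v, a *: v \in U}.

#[using="IMl IMr UZ IZ"]
Definition mod_quot : Type := {ideal_quot U}.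

Local Notation VU := mod_quot.

HB.instance Definition _ := GRing.Zmodule.copy VU {ideal_quot U}.

Definition mq_pi (v : V) : VU := \pi_({ideal_quot U}) v.
Definition mq_repr (v : VU) : V := qrepr (v : {ideal_quot U}).
Definition mq_scale (a : AI) (v : VU) : VU := mq_pi (rq_repr a *: mq_repr v).

Lemma mq_reprK v : mq_pi (mq_repr v) = v. Proof. exact: reprK. Qed.

Lemma mq_eqP u v : reflect (mq_pi u = mq_pi v) (u - v \in U).
Proof. exact: quot_eqP. Qed.

Lemma mq_piD a b : mq_pi (a + b) = mq_pi a + mq_pi b.
Proof. exact: (raddfD (\pi_({ideal_quot U}))). Qed.

Lemma mq_repr_piB v : mq_repr (mq_pi v) - v \in U.
Proof. exact: repr_quotB. Qed.

Lemma mq_scaleE a v : mq_scale (rq_pi a) (mq_pi v) = mq_pi (a *: v).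
Proof.
apply/mq_eqP; have Ia := rq_repr_piB a; have Uv := mq_repr_piB v.
set a' := rq_repr _ in Ia *; set v' := mq_repr _ in Uv *.
have -> : a' *: v' - a *: v = (a' - a) *: v' + a *: (v' - v).
  by rewrite scalerBl scalerBr addrA subrK.
by apply: rpredD; [exact: IZ | exact: UZ].
Qed.

Lemma mq_scaleA a b v : mq_scale a (mq_scale b v) = mq_scale (a * b) v.
Proof.
rewrite -[a]rq_reprK -[b]rq_reprK -[v]mq_reprK.
by rewrite -rq_piM !mq_scaleE scalerA.
Qed.
Lemma mq_scale1 : left_id 1 mq_scale.
Proof. by move=> v; rewrite -[v]mq_reprK mq_scaleE scale1r. Qed.
Lemma mq_scaleDr : right_distributive mq_scale +%R.
Proof.
move=> a u v; rewrite -[a]rq_reprK -[u]mq_reprK -[v]mq_reprK.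
by rewrite -mq_piD !mq_scaleE scalerDr mq_piD.
Qed.
Lemma mq_scaleDl v : {morph mq_scale^~ v : a b / a + b}.
Proof.
move=> a b; rewrite -[a]rq_reprK -[b]rq_reprK -[v]mq_reprK.
by rewrite -rq_piD !mq_scaleE scalerDl mq_piD.
Qed.

HB.instance Definition _ := GRing.Zmodule_isLmodule.Build AI VU
  mq_scaleA mq_scale1 mq_scaleDr mq_scaleDl.

Lemma mq_piZ a v : mq_pi (a *: v) = rq_pi a *: mq_pi v.
Proof. by rewrite -mq_scaleE. Qed.

End RingQuot.

Record ring_action (W : finGroupType) (S : pzRingType) := RingAction {
  ract :> W -> S -> S;
  ract_add : forall w, {morph ract w : a b / a + b};
  ract_mul : forall w, {morph ract w : a b / a * b};
  ract_one : forall w, ract w 1 = 1;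
  ract1 : forall a, ract 1%g a = a;
  ractM : forall v w a, ract (v * w)%g a = ract v (ract w a) }.

Section Skew.
Variables (W : finGroupType) (S : pzRingType) (al : ring_action W S).

(** An element [f] stands for the formal sum [\sum_w (f w) w]. *)
#[using="al"]
Definition skew : Type := {ffun W -> S}.

Local Notation SW := skew.

HB.instance Definition _ := GRing.Zmodule.copy SW {ffun W -> S}.

Definition skew_fun (f : SW) : {ffun W -> S} := f.
Definition skew_mk (f : {ffun W -> S}) : SW := f.
Definition skew_elt (s : S) (w : W) : SW :=
  skew_mk [ffun x => if x == w then s else 0].
Definition skew_one : SW := skew_elt 1 1%g.
(** Extends [(s w) (s' w') = (s * al w s') (w w')] additively, see
    [skew_eltM]. *)
Definition skew_mul (f g : SW) : SW := skew_mk
  [ffun x => \sum_(w : W) skew_fun f w * al w (skew_fun g (w^-1 * x)%g)].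

Fact ract_is_zmod w : zmod_morphism (al w).
Proof.
by move=> a b; apply: (addIr (al w b)); rewrite -ract_add !subrK.
Qed.
HB.instance Definition _ w := GRing.isZmodMorphism.Build S S (al w)
  (ract_is_zmod w).

Lemma skew_funP (f g : SW) : skew_fun f =1 skew_fun g -> f = g.
Proof. by move=> fg; apply/ffunP. Qed.

Lemma skew_funD f g x : skew_fun (f + g) x = skew_fun f x + skew_fun g x.
Proof. exact: ffunE. Qed.

Lemma skew_fun_elt s w x : skew_fun (skew_elt s w) x = if x == w then s else 0.
Proof. exact: ffunE. Qed.

Lemma skew_mulE f g x : skew_fun (skew_mul f g) x =
  \sum_(w : W) skew_fun f w * al w (skew_fun g (w^-1 * x)%g).
Proof. exact: ffunE. Qed.

Lemma skew_mulA : associative skew_mul.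
Proof.
move=> f g h; apply: skew_funP => x; rewrite !skew_mulE.
under eq_bigr do rewrite skew_mulE raddf_sum mulr_sumr.
under [RHS]eq_bigr do rewrite skew_mulE mulr_suml.
rewrite [RHS]exchange_big /=; apply: eq_bigr => u _.
rewrite [RHS](reindex_inj (mulgI u)) /=; apply: eq_bigr => w _.
by rewrite mulKg ract_mul ractM mulrA invMg mulgA.
Qed.
Lemma skew_mul1 : left_id skew_one skew_mul.
Proof.
move=> f; apply: skew_funP => x; rewrite skew_mulE.
rewrite (bigD1 1%g) //= big1 => [|w w1]; rewrite skew_fun_elt.
  by rewrite eqxx mul1r ract1 invg1 mul1g addr0.
by rewrite (negPf w1) mul0r.
Qed.
Lemma skew_mulr1 : right_id skew_one skew_mul.
Proof.
move=> f; apply: skew_funP => x; rewrite skew_mulE.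
rewrite (bigD1 x) //= big1 => [|w w1]; rewrite skew_fun_elt.
  by rewrite mulVg eqxx ract_one mulr1 addr0.
by rewrite -eq_mulVg1 (negPf w1) raddf0 mulr0.
Qed.
Lemma skew_mulDl : left_distributive skew_mul +%R.
Proof.
move=> f g h; apply: skew_funP => x; rewrite skew_funD !skew_mulE.
by rewrite -big_split; apply: eq_bigr => w _; rewrite skew_funD mulrDl.
Qed.
Lemma skew_mulDr : right_distributive skew_mul +%R.
Proof.
move=> f g h; apply: skew_funP => x; rewrite skew_funD !skew_mulE.
by rewrite -big_split; apply: eq_bigr => w _; rewrite skew_funD raddfD mulrDr.
Qed.

HB.instance Definition _ := GRing.Zmodule_isPzRing.Build SW
  skew_mulA skew_mul1 skew_mulr1 skew_mulDl skew_mulDr.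

Lemma skew_eltM s s' w w' :
  skew_elt s w * skew_elt s' w' = skew_elt (s * al w s') (w * w')%g.
Proof.
apply: skew_funP => x; rewrite skew_mulE.
rewrite (bigD1 w) //= big1 => [|v vw]; rewrite !skew_fun_elt.
  rewrite eqxx addr0 (canF_eq (mulKVg w)).
  by case: ifP; rewrite ?raddf0 ?mulr0.
by rewrite (negPf vw) mul0r.
Qed.

Record semi_action (V : lmodType S) := SemiAction {
  sact :> W -> V -> V;
  sact_add : forall w, {morph sact w : u v / u + v};
  sact1 : forall v, sact 1%g v = v;
  sactM : forall w w' v, sact (w * w')%g v = sact w (sact w' v);
  sactZ : forall w s v, sact w (s *: v) = al w s *: sact w v }.

Section SkewMod.
Variables (V : lmodType S) (phi : semi_action V).

#[using="phi"]
Definition skew_mod : Type := V.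
Local Notation Vphi := skew_mod.

HB.instance Definition _ := GRing.Zmodule.copy Vphi V.

(** The module over the skew group ring given by the pair [(V, phi)]. *)
Definition skew_scale (f : SW) (v : Vphi) : Vphi :=
  \sum_(w : W) skew_fun f w *: phi w (v : V).

Fact sact_is_zmod w : zmod_morphism (phi w).
Proof.
by move=> a b; apply: (addIr (phi w b)); rewrite -sact_add !subrK.
Qed.
HB.instance Definition _ w := GRing.isZmodMorphism.Build V V (phi w)
  (sact_is_zmod w).

Lemma skew_scaleA f g v : skew_scale f (skew_scale g v) = skew_scale (f * g) v.
Proof.
rewrite /skew_scale.
under eq_bigr do rewrite raddf_sum scaler_sumr.
under [RHS]eq_bigr do rewrite skew_mulE scaler_suml.
rewrite [RHS]exchange_big /=; apply: eq_bigr => u _.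
rewrite [RHS](reindex_inj (mulgI u)) /=; apply: eq_bigr => w _.
by rewrite mulKg sactZ scalerA sactM.
Qed.
Lemma skew_scale1 : left_id 1 skew_scale.
Proof.
move=> v; rewrite /skew_scale (bigD1 1%g) //= big1 => [|w w1].
  by rewrite skew_fun_elt eqxx scale1r sact1 addr0.
by rewrite skew_fun_elt (negPf w1) scale0r.
Qed.
Lemma skew_scaleDr : right_distributive skew_scale +%R.
Proof.
move=> f u v; rewrite /skew_scale -big_split; apply: eq_bigr => w _.
by rewrite sact_add scalerDr.
Qed.
Lemma skew_scaleDl v : {morph skew_scale^~ v : f g / f + g}.
Proof.
move=> f g; rewrite /skew_scale -big_split; apply: eq_bigr => w _.
by rewrite skew_funD scalerDl.
Qed.

HB.instance Definition _ := GRing.Zmodule_isLmodule.Build SW Vphi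
  skew_scaleA skew_scale1 skew_scaleDr skew_scaleDl.

Lemma skew_scale_elt s w (v : Vphi) :
  skew_elt s w *: v = (s *: phi w (v : V) : V).
Proof.
rewrite /GRing.scale /= /skew_scale (bigD1 w) //= big1 => [|u uw].
  by rewrite skew_fun_elt eqxx addr0.
by rewrite skew_fun_elt (negPf uw) scale0r.
Qed.

End SkewMod.
End Skew.

(** The finite group is the whole finGroupType [gT], so that its subgroups are
    the [H : {group gT}].  MathComp's [H :^ x] is [x^-1 H x]; the conjugate
    [g H g^-1] is thus [H :^ g^-1].  The conjugation [c_{g,H}] is presented as a
    map [M H -> M K] for any [K] equal to [H :^ g^-1], which avoids transports
    along equalities of subgroups. *)

Fact mackey_conj (gT : finGroupType) (L K : {group gT}) (x : gT) :
  (L :&: K :^ x^-1)%G = ((L :^ x :&: K) :^ x^-1)%G.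
Proof. by apply: val_inj; rewrite /= conjIg conjsgK. Qed.

(** [L \ H / K]. *)
Definition double_cosets (gT : finGroupType) (L H K : {group gT}) :
  {set {set gT}} := [set ((L :* x) * K)%g | x in H].

Record mackey (gT : finGroupType) (M : {group gT} -> zmodType) := MackeyStruct {
  res : forall K H : {group gT}, K \subset H -> {additive M H -> M K};
  ind : forall K H : {group gT}, K \subset H -> {additive M K -> M H};
  cnj : forall (g : gT) (H K : {group gT}),
    K = (H :^ g^-1)%G -> {additive M H -> M K};

  res_id : forall (H : {group gT}) (sHH : H \subset H) x, res sHH x = x;
  ind_id : forall (H : {group gT}) (sHH : H \subset H) x, ind sHH x = x;
  res_trans : forall (L K H : {group gT}) (sLK : L \subset K)
    (sKH : K \subset H) (sLH : L \subset H) x,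
    res sLK (res sKH x) = res sLH x;
  ind_trans : forall (L K H : {group gT}) (sLK : L \subset K)
    (sKH : K \subset H) (sLH : L \subset H) x,
    ind sKH (ind sLK x) = ind sLH x;

  cnj_comp : forall (g g' : gT) (H K L : {group gT})
    (eK : K = (H :^ g'^-1)%G) (eL : L = (K :^ g^-1)%G)
    (eHL : L = (H :^ (g * g')^-1)%G) x,
    cnj eL (cnj eK x) = cnj eHL x;
  cnj_id : forall (h : gT) (H : {group gT}) (eH : H = (H :^ h^-1)%G) x,
    h \in H -> cnj eH x = x;

  cnj_res : forall (g : gT) (K H K' H' : {group gT})
    (sKH : K \subset H) (sKH' : K' \subset H')
    (eK : K' = (K :^ g^-1)%G) (eH : H' = (H :^ g^-1)%G) x,
    cnj eK (res sKH x) = res sKH' (cnj eH x);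
  cnj_ind : forall (g : gT) (K H K' H' : {group gT})
    (sKH : K \subset H) (sKH' : K' \subset H')
    (eK : K' = (K :^ g^-1)%G) (eH : H' = (H :^ g^-1)%G) x,
    cnj eH (ind sKH x) = ind sKH' (cnj eK x);

  mackey_formula : forall (K L H : {group gT}) (sKH : K \subset H)
    (sLH : L \subset H) (y : M K),
    res sLH (ind sKH y) =
      \sum_(D in double_cosets L H K)
        let x := repr D in
        ind (subsetIl L (K :^ x^-1)%G : (L :&: K :^ x^-1)%G \subset L)
          (cnj (mackey_conj L K x)
            (res (subsetIr (L :^ x)%G K : (L :^ x :&: K)%G \subset K) y)) }.

(** [pzRingType] because [R H] and its Brauer quotient may be the zero ring. *)
Record green (gT : finGroupType) := Green {
  gr :> {group gT} -> pzRingType;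
  gr_mackey : mackey (fun H => gr H : zmodType);
  gr_res1 : forall (K H : {group gT}) (s : K \subset H), res gr_mackey s 1 = 1;
  gr_resM : forall (K H : {group gT}) (s : K \subset H),
    {morph res gr_mackey s : a b / a * b};
  gr_cnj1 : forall (g : gT) (H K : {group gT}) (e : K = (H :^ g^-1)%G),
    cnj gr_mackey e 1 = 1;
  gr_cnjM : forall (g : gT) (H K : {group gT}) (e : K = (H :^ g^-1)%G),
    {morph cnj gr_mackey e : a b / a * b};
  gr_ind_resl : forall (K H : {group gT}) (s : K \subset H) (r : gr H) (r' : gr K),
    ind gr_mackey s (res gr_mackey s r * r') = r * ind gr_mackey s r';
  gr_ind_resr : forall (K H : {group gT}) (s : K \subset H) (r : gr K) (r' : gr H),
    ind gr_mackey s (r * res gr_mackey s r') = ind gr_mackey s r * r' }.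

Arguments gr_mackey {gT} R : rename.

Section GreenModules.
Variables (gT : finGroupType) (R : green gT).

Record green_mod := GreenMod {
  gm :> forall H : {group gT}, lmodType (R H);
  gm_mackey : mackey (fun H => gm H : zmodType);
  gm_resZ : forall (K H : {group gT}) (s : K \subset H) (r : R H) (m : gm H),
    res gm_mackey s (r *: m) = res (gr_mackey R) s r *: res gm_mackey s m;
  gm_cnjZ : forall (g : gT) (H K : {group gT}) (e : K = (H :^ g^-1)%G)
    (r : R H) (m : gm H),
    cnj gm_mackey e (r *: m) = cnj (gr_mackey R) e r *: cnj gm_mackey e m;
  gm_ind_resl : forall (K H : {group gT}) (s : K \subset H) (r : R H) (m : gm K),
    ind gm_mackey s (res (gr_mackey R) s r *: m) = r *: ind gm_mackey s m;
  gm_ind_resr : forall (K H : {group gT}) (s : K \subset H) (r : R K) (m : gm H),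
    ind gm_mackey s (r *: res gm_mackey s m) = ind (gr_mackey R) s r *: m }.

Arguments gm_mackey M : rename.

Record green_hom (M N : green_mod) := GreenHom {
  gh :> forall H : {group gT}, M H -> N H;
  gh_lin : forall H : {group gT}, linear (@gh H);
  gh_res : forall (K H : {group gT}) (s : K \subset H) (m : M H),
    @gh K (res (gm_mackey M) s m) = res (gm_mackey N) s (@gh H m);
  gh_ind : forall (K H : {group gT}) (s : K \subset H) (m : M K),
    @gh H (ind (gm_mackey M) s m) = ind (gm_mackey N) s (@gh K m);
  gh_cnj : forall (g : gT) (H K : {group gT}) (e : K = (H :^ g^-1)%G) (m : M H),
    @gh K (cnj (gm_mackey M) e m) = cnj (gm_mackey N) e (@gh H m) }.

Arguments gh {M N} f H m : rename.

Lemma green_hom_eq (M N : green_mod) (f g : green_hom M N) :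
  (forall H m, f H m = g H m) -> f = g.
Proof.
case: f g => [f f1 f2 f3 f4] [g g1 g2 g3 g4] /= fg.
have e : f = g.
  by apply: functional_extensionality_dep => H; apply/funext => m; exact: fg.
case: _ / e g1 g2 g3 g4 {fg} => g1 g2 g3 g4.
by congr GreenHom; exact: Prop_irrelevance.
Qed.

Definition green_idm (M : green_mod) : green_hom M M.
Proof. exact: (@GreenHom M M (fun H m => m)). Defined.

Definition green_comp (M N P : green_mod)
  (g : green_hom N P) (f : green_hom M N) : green_hom M P.
Proof.
refine (@GreenHom M P (fun H m => g H (f H m)) _ _ _ _).
- by move=> H a u v; rewrite !gh_lin.
- by move=> K H s m; rewrite !gh_res.
- by move=> K H s m; rewrite !gh_ind.
- by move=> x H K e m; rewrite !gh_cnj.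
Defined.

Definition green_Mack : category.
Proof.
refine (@Category green_mod green_hom green_idm green_comp _ _ _).
- by move=> X Y f; exact: green_hom_eq.
- by move=> X Y f; exact: green_hom_eq.
- by move=> X Y Z T h g f; exact: green_hom_eq.
Defined.

(** [R_Q]-modules, as the Q-local [R]-modules. *)
Definition QMack (Q : subringClosed rat) : category :=
  @full_sub green_Mack (fun M : green_mod => forall H, Qlocal Q (M H)).

End GreenModules.

Arguments gm_mackey {gT R} M : rename.
Arguments gh {gT R M N} f H m : rename.
Arguments gh_lin {gT R M N} f H a u v : rename.

Section BrauerSub.
Variables (gT : finGroupType) (M : {group gT} -> zmodType) (mm : mackey M).

(** The subgroup [\sum_(K < H) ind_K^H (M K)] of [M H]. *)
Definition brauer_sub (H : {group gT}) : {pred M H} := fun x =>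
  `[< exists y : forall K : {K : {group gT} | K \proper H}, M (val K),
        x = \sum_(K : {K : {group gT} | K \proper H})
              ind mm (proper_sub (valP K)) (y K) >].

Lemma brauer_subP (H : {group gT}) (x : M H) :
  reflect (exists y : forall K : {K : {group gT} | K \proper H}, M (val K),
    x = \sum_(K : {K : {group gT} | K \proper H})
          ind mm (proper_sub (valP K)) (y K)) (x \in @brauer_sub H).
Proof. exact: asboolP. Qed.

Fact brauer_sub_zmod (H : {group gT}) : zmod_closed (@brauer_sub H).
Proof.
split=> [|x x' /brauer_subP[y ->] /brauer_subP[y' ->]]; apply/brauer_subP.
  by exists (fun=> 0); rewrite big1 // => K _; rewrite raddf0.
exists (fun K => y K - y' K); rewrite -sumrB.
by apply: eq_bigr => K _; rewrite raddfB.
Qed.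

HB.instance Definition _ (H : {group gT}) :=
  GRing.isZmodClosed.Build (M H) (@brauer_sub H) (brauer_sub_zmod H).

Lemma brauer_sub_ind (K H : {group gT}) (s : K \subset H) (y : M K) :
  K \proper H -> ind mm s y \in @brauer_sub H.
Proof.
move=> pK; apply/brauer_subP.
pose z (L : {L : {group gT} | L \proper H}) : M (val L) :=
  if pselect (K = val L) is left e then ecast L (M L) e y else 0.
exists z; rewrite (bigD1 (exist _ K pK)) //= big1 => [|L LK].
  rewrite addr0 /z; case: pselect => // e /=.
  by rewrite (eq_irrelevance e erefl) /=; congr (ind mm _ y); exact: eq_irrelevance.
rewrite /z; case: pselect => [e|_]; last by rewrite raddf0.
by case/eqP: LK; apply: val_inj.
Qed.

Lemma cnj_eq (g g' : gT) (H K : {group gT}) (e : K = (H :^ g^-1)%G)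
  (e' : K = (H :^ g'^-1)%G) x : g = g' -> cnj mm e x = cnj mm e' x.
Proof. by move=> gg; case: _ / gg e' => e'; rewrite (eq_irrelevance e e'). Qed.

(** The action of [W_G(H)], which is [coset_of H]: a coset acts through any of
    its elements, see [wcnjE]. *)
Fact wcnj_subproof (H : {group gT}) (w : coset_of H) :
  H = (H :^ (repr w)^-1)%G.
Proof.
by apply: val_inj; rewrite /= (normP _) // groupV repr_coset_norm.
Qed.

Definition wcnj (H : {group gT}) (w : coset_of H) : {additive M H -> M H} :=
  cnj mm (wcnj_subproof w).

Lemma wcnjE (H : {group gT}) (g : gT) (e : H = (H :^ g^-1)%G) x :
  g \in 'N(H)%g -> wcnj (coset H g) x = cnj mm e x.
Proof.
move=> Ng.
have : repr (coset H g) \in (H :* g)%g.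
  by have := mem_repr_coset (coset H g); rewrite {2}val_coset.
case/rcosetP=> h Hh rE.
have eh : H = (H :^ h^-1)%G.
  by apply: val_inj; rewrite /= (normP _) // groupV (subsetP (normG H)).
have ehg : H = (H :^ (h * g)^-1)%G by rewrite -rE; exact: wcnj_subproof.
by rewrite /wcnj (cnj_eq _ ehg) // -(cnj_comp mm e eh) cnj_id.
Qed.

Lemma wcnj1 (H : {group gT}) x : wcnj (1%g : coset_of H) x = x.
Proof. by rewrite /wcnj cnj_id // repr_coset1 group1. Qed.

Lemma wcnjM (H : {group gT}) (v w : coset_of H) x :
  wcnj (v * w)%g x = wcnj v (wcnj w x).
Proof.
have Nv := repr_coset_norm v; have Nw := repr_coset_norm w.
have e : H = (H :^ (repr v * repr w)^-1)%G.
  by apply: val_inj; rewrite /= (normP _) // groupV groupM.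
rewrite [RHS](cnj_comp mm _ _ e) -wcnjE ?groupM // morphM //=.
by rewrite !coset_reprK.
Qed.

End BrauerSub.

Arguments brauer_sub {gT M} mm H _.

Lemma brauer_sub_map (gT : finGroupType) (M N : {group gT} -> zmodType)
  (mm : mackey M) (mn : mackey N) (H H' : {group gT})
  (f : {additive M H -> N H'}) :
  (forall (K : {group gT}) (s : K \subset H) (y : M K), K \proper H ->
     f (ind mm s y) \in brauer_sub mn H') ->
  {in brauer_sub mm H, forall x, f x \in brauer_sub mn H'}.
Proof.
move=> fi x /brauer_subP[y ->]; rewrite raddf_sum rpred_sum // => K _.
exact: fi (valP K).
Qed.

Lemma brauer_sub_wcnj (gT : finGroupType) (M : {group gT} -> zmodType)
  (mm : mackey M) (H : {group gT}) (w : coset_of H) :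
  {in brauer_sub mm H, forall x, wcnj mm w x \in brauer_sub mm H}.
Proof.
apply: brauer_sub_map => K s y pK.
have e := wcnj_subproof w; set g := repr w in e.
have pK' : (K :^ g^-1)%G \proper H.
  move: pK; rewrite -(properJ K H g^-1).
  have -> : (H :^ g^-1)%g = H :> {set gT}; last by [].
  by rewrite (normP _) // groupV repr_coset_norm.
rewrite /wcnj (cnj_ind mm s (proper_sub pK') (erefl _)).
exact: brauer_sub_ind.
Qed.

Section Brauer.
Variables (gT : finGroupType) (R : green gT).
Implicit Types (H : {group gT}) (M : green_mod R).

Local Notation I H := (brauer_sub (gr_mackey R) H).
Local Notation U M H := (brauer_sub (gm_mackey M) H).

Fact bring_l H (a : R H) : {in I H, forall u : R H, a * u \in I H}.
Proof.
move=> u /brauer_subP[y ->]; rewrite mulr_sumr; apply: rpred_sum => K _.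
by rewrite -gr_ind_resl brauer_sub_ind // (valP K).
Qed.
Fact bring_r H (a : R H) : {in I H, forall u : R H, u * a \in I H}.
Proof.
move=> u /brauer_subP[y ->]; rewrite mulr_suml; apply: rpred_sum => K _.
by rewrite -gr_ind_resr brauer_sub_ind // (valP K).
Qed.
Fact bmod_l M H (a : R H) : {in U M H, forall u : M H, a *: u \in U M H}.
Proof.
move=> u /brauer_subP[y ->]; rewrite scaler_sumr; apply: rpred_sum => K _.
by rewrite -gm_ind_resl brauer_sub_ind // (valP K).
Qed.
Fact bmod_r M H : {in I H, forall (a : R H) (v : M H), a *: v \in U M H}.
Proof.
move=> a /brauer_subP[y ->] v; rewrite scaler_suml; apply: rpred_sum => K _.
by rewrite -gm_ind_resr brauer_sub_ind // (valP K).
Qed.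

Definition brauer_ring H : pzRingType := ring_quot (@bring_l H) (@bring_r H).

Definition brauer_lmod M H : lmodType (brauer_ring H) :=
  mod_quot (@bring_l H) (@bring_r H) (@bmod_l M H) (@bmod_r M H).

Definition bring_pi H (a : R H) : brauer_ring H :=
  rq_pi (@bring_l H) (@bring_r H) a.
Definition bmod_pi M H (m : M H) : brauer_lmod M H :=
  mq_pi (@bring_l H) (@bring_r H) (@bmod_l M H) (@bmod_r M H) m.

Lemma bring_piP H (x : brauer_ring H) : exists a, x = bring_pi a.
Proof. by exists (rq_repr x); rewrite [RHS]rq_reprK. Qed.
Lemma bmod_piP M H (x : brauer_lmod M H) : exists m, x = bmod_pi m.
Proof. by exists (mq_repr x); rewrite [RHS]mq_reprK. Qed.
Lemma bmod_piD M H (u v : M H) : bmod_pi (u + v) = bmod_pi u + bmod_pi v.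
Proof. exact: mq_piD. Qed.
Lemma bmod_piZ M H (a : R H) (v : M H) :
  bmod_pi (a *: v) = bring_pi a *: bmod_pi v.
Proof. exact: mq_piZ. Qed.

Definition bring_cnj H (w : coset_of H) : brauer_ring H -> brauer_ring H :=
  @quot_map _ _ (I H) (I H) (wcnj (gr_mackey R) w).
Definition bmod_cnj M H (w : coset_of H) : brauer_lmod M H -> brauer_lmod M H :=
  @quot_map _ _ (U M H) (U M H) (wcnj (gm_mackey M) w).

Lemma bring_cnjE H (w : coset_of H) (a : R H) :
  bring_cnj w (bring_pi a) = bring_pi (wcnj (gr_mackey R) w a).
Proof.
exact: (quot_mapE (f := wcnj (gr_mackey R) w) (@brauer_sub_wcnj _ _ _ _ w)).
Qed.
Lemma bmod_cnjE M H (w : coset_of H) (m : M H) :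
  bmod_cnj w (bmod_pi m) = bmod_pi (wcnj (gm_mackey M) w m).
Proof.
exact: (quot_mapE (f := wcnj (gm_mackey M) w) (@brauer_sub_wcnj _ _ _ _ w)).
Qed.

Definition brauer_ract H : ring_action (coset_of H) (brauer_ring H).
Proof.
refine (@RingAction (coset_of H) _ (@bring_cnj H) _ _ _ _ _).
- move=> w x y; case: (bring_piP x) (bring_piP y) => [a ->] [b ->].
  by rewrite -[in LHS]rq_piD !bring_cnjE raddfD [LHS]rq_piD.
- move=> w x y; case: (bring_piP x) (bring_piP y) => [a ->] [b ->].
  by rewrite -[in LHS]rq_piM !bring_cnjE gr_cnjM [LHS]rq_piM.
- by move=> w; rewrite [LHS]bring_cnjE /wcnj gr_cnj1.
- by move=> x; case: (bring_piP x) => a ->; rewrite bring_cnjE wcnj1.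
- by move=> v w x; case: (bring_piP x) => a ->; rewrite !bring_cnjE wcnjM.
Defined.

Definition brauer_sact M H : semi_action (brauer_ract H) (brauer_lmod M H).
Proof.
refine (@SemiAction (coset_of H) _ (brauer_ract H) _ (@bmod_cnj M H) _ _ _ _).
- move=> w x y; case: (bmod_piP x) (bmod_piP y) => [u ->] [v ->].
  by rewrite -bmod_piD !bmod_cnjE raddfD bmod_piD.
- by move=> x; case: (bmod_piP x) => u ->; rewrite bmod_cnjE wcnj1.
- by move=> v w x; case: (bmod_piP x) => u ->; rewrite !bmod_cnjE wcnjM.
- move=> w s x; case: (bring_piP s) (bmod_piP x) => [a ->] [u ->].
  by rewrite -bmod_piZ !bmod_cnjE /= bring_cnjE gm_cnjZ bmod_piZ.
Defined.

Definition brauer_skew H : pzRingType := skew (brauer_ract H).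

Definition brauer_obj H M : lmodType (brauer_skew H) :=
  skew_mod (brauer_sact M H).

Lemma brauer_map_subproof H M N (f : green_hom M N) :
  exists2 g : {additive M H -> N H}, g =1 gh f H &
    {in U M H, forall x, g x \in U N H}.
Proof.
have [g gE] : {g : {additive M H -> N H} | g =1 gh f H}.
  by apply: additive_pack => u v; have := gh_lin f H 1 u v; rewrite !scale1r.
exists g => //; apply: brauer_sub_map => K s y pK.
by rewrite gE gh_ind brauer_sub_ind.
Qed.

Definition brauer_fun H M N (f : green_hom M N) :
  brauer_lmod M H -> brauer_lmod N H :=
  @quot_map _ _ (U M H) (U N H) (gh f H).

Lemma brauer_funE H M N (f : green_hom M N) (m : M H) :
  brauer_fun f (bmod_pi m) = bmod_pi (gh f H m).
Proof.
have [g /funext gE gU] := brauer_map_subproof H f.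
by rewrite /brauer_fun -gE; exact: (quot_mapE gU).
Qed.

Fact brauer_fun_lin H M N (f : green_hom M N) :
  linear (brauer_fun f : brauer_obj H M -> brauer_obj H N).
Proof.
have fD : {morph (@brauer_fun H _ _ f) : x y / x + y}.
  move=> x y; case: (bmod_piP x) (bmod_piP y) => [u ->] [v ->].
  rewrite -bmod_piD !brauer_funE -[RHS]bmod_piD; congr bmod_pi.
  by have := gh_lin f H 1 u v; rewrite !scale1r.
have fZ a x : @brauer_fun H _ _ f (a *: x) = a *: brauer_fun f x.
  case: (bring_piP a) (bmod_piP x) => [b ->] [u ->].
  rewrite -bmod_piZ !brauer_funE -bmod_piZ; congr bmod_pi.
  have g0 : gh f H 0 = 0.
    apply: (addIr (gh f H 0)); have := gh_lin f H 1 0 0.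
    by rewrite !scale1r !add0r => <-.
  by have := gh_lin f H b u 0; rewrite g0 !addr0.
have fS w x : @brauer_fun H _ _ f (brauer_sact M H w x) =
    brauer_sact N H w (brauer_fun f x).
  case: (bmod_piP x) => u ->.
  by rewrite /= bmod_cnjE !brauer_funE bmod_cnjE /wcnj gh_cnj.
have [g gE] := additive_pack fD.
move=> a x y; rewrite [LHS]fD; congr (_ + _).
rewrite /GRing.scale /= /skew_scale -gE raddf_sum.
by apply: eq_bigr => w _; rewrite gE fZ fS.
Qed.

Definition brauer_map H M N (f : green_hom M N) :
  mod_hom (brauer_obj H M) (brauer_obj H N) := ModHom (brauer_fun_lin f).

Definition brauerF H : functor (green_Mack R) (Mod (brauer_skew H)).
Proof.
refine (@Functor (green_Mack R) (Mod (brauer_skew H)) (brauer_obj H)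
  (@brauer_map H) _ _).
- by move=> M; apply: mod_hom_eq => x; case: (bmod_piP x) => m ->;
    rewrite /= brauer_funE.
- by move=> M N P g f; apply: mod_hom_eq => x; case: (bmod_piP x) => m ->;
    rewrite /= !brauer_funE.
Defined.

Lemma brauer_Qlocal (Q : subringClosed rat) H M :
  (forall K, Qlocal Q (M K)) -> Qlocal Q (brauer_obj H M).
Proof.
move=> QM; have [act [act1 actM actDl actDr]] := QM H.
pose bact q (x : brauer_lmod M H) : brauer_lmod M H := bmod_pi (act q (mq_repr x)).
have bactE q : q \in Q -> forall m, bact q (bmod_pi m) = bmod_pi (act q m).
  move=> Qq m; have [g gE] := additive_pack (actDr q Qq).
  have gU : {in U M H, forall x, g x \in U M H}.
    apply: brauer_sub_map => K s y pK; have [actK QK] := QM K.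
    rewrite gE -(Qlocal_additive QK _ (ind (gm_mackey M) s)) ?brauer_sub_ind //.
  rewrite /bact -[in RHS]gE -gE; exact: (quot_mapE gU m).
exists bact; split.
- by move=> x; case: (bmod_piP x) => m ->; rewrite bactE ?rpred1 ?act1.
- move=> p q Qp Qq x; case: (bmod_piP x) => m ->.
  by rewrite !bactE ?rpredM // actM.
- move=> p q Qp Qq x; case: (bmod_piP x) => m ->.
  by rewrite !bactE ?rpredD // actDl // [LHS]bmod_piD.
- move=> q Qq x y; case: (bmod_piP x) (bmod_piP y) => [u ->] [v ->].
  by rewrite -[in LHS]bmod_piD !bactE // actDr // [LHS]bmod_piD.
Qed.

Section Products.
Variable T : {set {group gT}}.

Local Notation rep := {H : {group gT} | H \in T}.

Definition Br : functor (green_Mack R)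
    (prod_cat (fun H : rep =>
       Mod (brauer_skew (val H)))) :=
  @pairF (green_Mack R) _ (fun H : rep => Mod (brauer_skew (val H)))
    (fun H : rep => brauerF (val H)).

(** Restriction of [Br] to Q-local objects on both sides. *)
Definition BrQ (Q : subringClosed rat) : functor (QMack R Q)
    (prod_cat (fun H : rep =>
       QMod Q (brauer_skew (val H)))) :=
  @pairF (QMack R Q) _ (fun H : rep => QMod Q (brauer_skew (val H)))
    (fun H : rep => @restrictF _ _ (brauerF (val H)) _ _ (@brauer_Qlocal Q (val H))).

End Products.
End Brauer.

(** [T] contains exactly one subgroup of each conjugacy class. *)
Definition class_reps (gT : finGroupType) (T : {set {group gT}}) : Prop :=
  is_transversal T [set orbit 'JG%act [set: gT] H | H : {group gT}]
    [set: {group gT}].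

(* Main.v *)
From HB Require Import structures.
From mathcomp Require Import all_boot all_fingroup all_algebra.
From mathcomp Require Import boolp.
Require Import Defs.

(** An inverse of the Brauer quotient functor can be written down.  Given a
    module [V H] over the skew group ring of each chosen representative [H],
    transport the [V H] to all subgroups by conjugation and let the value of
    the inverse at [A] be the module of [A]-invariant families indexed by the
    subgroups of [A].  Restriction forgets components, conjugation permutes
    them, and induction from [A] to [B] extends by zero and takes the trace
    from [A] to [B].  The ring [R A] acts on the component at [B] through
    restriction to [B].  This is [ghost_mod] below.

    Both composites are compared with the identity by evident maps.

    - The unit [ghost_unit] sends [m] in [M A] to the family of the classes of
      its restrictions in the Brauer quotients of [M].  It commutes with
      induction because, modulo images of induction from proper subgroups, the
      Mackey formula for [res ind] keeps exactly the terms that describe the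
      trace ([mark_ind]).

    - The counit [ghost_counit] takes the component at the representative
      itself.

    That they are isomorphisms rests on two averaging formulas, and this is
    where the order of the group has to be invertible.

    - A family [f] in the value at [A] is [1 / #|A|] times the sum, over all
      subgroups [B] of [A], of [#|B|] times the induction of the component of
      [f] at [B] ([gdelta_decomp]).  Hence a family vanishing at [A] is a sum of
      elements induced from proper subgroups ([ghost_brauer_sub]).  It follows
      that the counit is bijective and, by induction on the order of [A], that
      the unit is surjective.

    - For the injectivity of the unit, it suffices, again by induction on the
      order of [A], that an element of [M A] vanishes as soon as it is a sum of
      elements induced from proper subgroups and restricts to zero on all
      proper subgroups ([brauer_sub_res_eq0]).  Filter [M A] by the spans of the
      elements induced from subgroups of order at most [j].  On the [j]-th
      graded piece the sum of the operators [ind res] over all subgroups of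
      order [j] is multiplication by [#|A| / j] ([ind_span_level]), but it kills
      the given element.  So multiples of this element by divisors of powers of
      [#|A|] descend through the filtration down to zero. *)

Set Implicit Arguments.
Unset Strict Implicit.
Unset Printing Implicit Defensive.

Import GroupScope GRing.Theory.

Local Open Scope ring_scope.

(** * Isomorphisms in the categories involved *)

Lemma inverse_hom_family (C D : category) (F G : functor C D)
  (t : forall X : C, hom (F X) (G X)) : (forall X, is_iso (t X)) ->
  {u : forall X : C, hom (G X) (F X) | forall X,
     comp (u X) (t X) = idm (F X) /\ comp (t X) (u X) = idm (G X)}.
Proof.
by move=> /(_ _)/cid tK; exists (fun X => sval (tK X)) => X; case: (tK X).
Qed.

Lemma nat_iso_sym (C D : category) (F G : functor C D) :
  nat_iso F G -> nat_iso G F.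
Proof.
case=> t [tN /inverse_hom_family[u uK]]; exists u; split=> [X Y f|X].
  have [ut tu] := uK X; have [ut' tu'] := uK Y.
  by rewrite -[LHS]compm1 -tu compA -(compA (u Y)) -tN compA ut' comp1m.
by exists (t X); case: (uK X).
Qed.

Lemma prod_cat_iso (I : Type) (D : I -> category) (X Y : prod_cat D)
  (f : hom X Y) : (forall i, is_iso (f i)) -> is_iso f.
Proof.
move=> /(_ _)/cid fK; exists (fun i => sval (fK i)).
by split; apply: functional_extensionality_dep => i /=; case: (fK i) => g [].
Qed.

Lemma mod_hom_iso (A : pzRingType) (V W : lmodType A)
    (f : @hom (Mod A) V W) : bijective f -> is_iso f.
Proof.
case=> g fK gK; have gl : linear g.
  by move=> a x y; apply: (can_inj fK); rewrite gK mod_lin !gK.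
by exists (ModHom gl); split; apply: mod_hom_eq => x /=; rewrite ?fK ?gK.
Qed.

Lemma green_hom_iso (gT : finGroupType) (R : green gT) (M N : green_mod R)
    (f : @hom (green_Mack R) M N) :
  (forall H, bijective (gh f H)) -> is_iso f.
Proof.
move=> fbij; have fbij' H : exists g, cancel (gh f H) g /\ cancel g (gh f H).
  by case: (fbij H) => g fK gK; exists g.
pose g H := sval (cid (fbij' H)).
have fK H : cancel (gh f H) (g H) by rewrite /g; case: cid => ? [].
have gK H : cancel (g H) (gh f H) by rewrite /g; case: cid => ? [].
unshelve eexists (@GreenHom _ _ N M g _ _ _ _).
- by move=> H a u v; apply: (can_inj (fK H)); rewrite gK gh_lin !gK.
- by move=> K H s m; apply: (can_inj (fK K)); rewrite gK gh_res !gK.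
- by move=> K H s m; apply: (can_inj (fK H)); rewrite gK gh_ind !gK.
- by move=> x H K e m; apply: (can_inj (fK K)); rewrite gK gh_cnj !gK.
by split; apply: green_hom_eq => H m /=; rewrite ?fK ?gK.
Qed.

(** * Unique divisibility *)

Section Divisible.
Variable N : nat.

(** This is all that the comparison maps need of Q-locality: for [N] the order
    of the group, elements can be divided by the order of any subgroup, and the
    quotient is unique. *)
Definition uniq_div (V : zmodType) : Prop :=
  (forall v : V, v *+ N = 0 -> v = 0) /\ (forall v : V, exists w, w *+ N = v).

Lemma Qlocal_uniq_div (Q : subringClosed rat) (V : zmodType) :
  (N > 0)%N -> (N%:R : rat)^-1 \in Q -> Qlocal Q V -> uniq_div V.
Proof.
move=> N0 QN [act Qa]; have [act1 actM _ actD] := Qa.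
have actN v : act N%:R v = v *+ N by rewrite (Qact_int Qa N).
have N0' : N%:R != 0 :> rat by rewrite Num.Theory.pnatr_eq0 -lt0n.
have QN' : N%:R \in Q by rewrite rpred_nat.
split=> v.
  move=> vN; rewrite -[v]act1 -(mulVf N0') actM // actN vN.
  by apply: (addIr (act N%:R^-1 0)); rewrite -actD ?add0r.
by exists (act (N%:R)^-1 v); rewrite -actN -actM // mulfV.
Qed.

Variables (V : zmodType) (n : nat).
Hypotheses (dV : uniq_div V) (nN : (n %| N)%N).

Lemma mulrn_inj_div : injective (fun v : V => v *+ n).
Proof.
move=> u v /= /eqP; rewrite -subr_eq0 -mulrnBl => /eqP uv; apply/eqP.
rewrite -subr_eq0; apply/eqP/dV.1.
by rewrite -(divnK nN) mulnC mulrnA uv mul0rn.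
Qed.

Lemma mulrn_surj_div (v : V) : exists w, w *+ n = v.
Proof.
have [w <-] := dV.2 v; exists (w *+ (N %/ n)).
by rewrite -mulrnA divnK.
Qed.

Definition divn_by (v : V) : V := sval (cid (mulrn_surj_div v)).

Lemma divn_byK v : divn_by v *+ n = v.
Proof. by rewrite /divn_by; case: cid. Qed.

End Divisible.

(** * Double cosets *)

Section DoubleCosets.
Variables (gT : finGroupType).
Implicit Types (H K L : {group gT}).

Lemma card_double_coset L K (x : gT) :
  (#|(L :* x) * K|%g * #|(L :&: K :^ x^-1)%G| = #|L| * #|K|)%N.
Proof.
have -> : ((L :* x) * K = (L * (K :^ x^-1)) :* x)%g.
  by rewrite conjsgE invgK -!mulgA mulg_set1 mulVg mulg1.
by rewrite card_rcoset -(cardJg K x^-1); exact/esym/mul_cardG.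
Qed.

(** Turns the sum over representatives in the Mackey formula into a sum over
    group elements, which can be reindexed freely. *)
Lemma sum_double_cosets (V : zmodType) L H K (F : gT -> V) :
  L \subset H -> K \subset H ->
  (forall l x k, l \in L -> x \in H -> k \in K -> F (l * x * k)%g = F x) ->
  \sum_(D in double_cosets L H K) F (repr D) *+ #|D| = \sum_(x in H) F x.
Proof.
move=> sLH sKH FE; rewrite [RHS](partition_big_imset
  (fun x => (L :* x) * K)%g) /=; apply: eq_bigr => D DD.
have DP y : (y \in H) && ((L :* y) * K == D)%g = (y \in D).
  case/imsetP: DD => x Hx ->; apply/andP/idP => [[Hy /eqP <-]|].
    by rewrite -{1}[y]mulg1 mem_mulg ?rcoset_refl.
  case/mulsgP=> _ k /rcosetP[l Ll ->] Kk ->; split.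
    by rewrite !groupM ?(subsetP sLH l) ?(subsetP sKH k).
  by rewrite rcosetM rcosetM (rcoset_id Ll) -mulgA (lcoset_id Kk).
have rD : repr D \in D.
  case/imsetP: DD => x Hx ->; apply: (mem_repr x).
  by rewrite -{1}[x]mulg1 mem_mulg ?rcoset_refl.
rewrite (eq_bigl _ _ DP) -sumr_const; apply: eq_bigr => y.
move: rD; rewrite -!DP => /andP[Hr /eqP rE] /andP[Hy /eqP yE].
have : y \in ((L :* repr D) * K)%g.
  by rewrite rE -yE -{1}[y]mulg1 mem_mulg ?rcoset_refl.
by case/mulsgP=> _ k /rcosetP[l Ll ->] Kk ->; rewrite FE.
Qed.

Lemma card_repr_double_coset L H K (D : {set gT}) : D \in double_cosets L H K ->
  (#|D| * #|(L :&: K :^ (repr D)^-1)%G| = #|L| * #|K|)%N.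
Proof.
case/imsetP=> x Hx DE; rewrite -(card_double_coset L K (repr D)).
have : repr D \in D.
  by rewrite DE (mem_repr x) // -{1}[x]mulg1 mem_mulg ?rcoset_refl.
set r := repr D => rD; congr (#|(_ : {set _})| * _)%N.
apply/esym; rewrite DE in rD *.
case/mulsgP: rD => _ k /rcosetP[l Ll ->] Kk ->.
by rewrite rcosetM rcosetM (rcoset_id Ll) -mulgA (lcoset_id Kk).
Qed.

End DoubleCosets.

(** * The Mackey formula and the filtration by order *)

Section MackeyTheory.
Variables (gT : finGroupType) (M : {group gT} -> zmodType) (mm : mackey M).
Implicit Types (H K L : {group gT}).

Lemma ind_conj_sub (L A A' : {group gT}) (sA : A \subset L) (sA' : A' \subset L)
    (l : gT) (e : A' = (A :^ l^-1)%G) (a : M A) :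
  l \in L -> ind mm sA' (cnj mm e a) = ind mm sA a.
Proof.
move=> Ll; have eL : L = (L :^ l^-1)%G.
  by apply: val_inj; rewrite /= conjGid ?groupV.
by rewrite -(cnj_ind mm sA sA' e eL) cnj_id.
Qed.

Definition mackey_term L K (y : M K) (x : gT) : M L :=
  ind mm (subsetIl L (K :^ x^-1)%G : (L :&: K :^ x^-1)%G \subset L)
    (cnj mm (mackey_conj L K x)
      (res mm (subsetIr (L :^ x)%G K : (L :^ x :&: K)%G \subset K) y)).

Lemma mackey_term_double_coset L K (y : M K) (l x k : gT) :
  l \in L -> k \in K -> mackey_term L y (l * x * k)%g = mackey_term L y x.
Proof.
move=> Ll Kk; rewrite /mackey_term.
have eB : (L :^ x :&: K)%G = ((L :^ (l * x * k) :&: K) :^ k^-1)%G.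
  apply: val_inj; rewrite /= conjIg -conjsgM mulgK conjsgM.
  by rewrite (conjGid Ll) (conjGid (groupVr Kk)).
have eK : K = (K :^ k^-1)%G by apply: val_inj; rewrite /= conjGid ?groupV.
have eA : (L :&: K :^ (l * x * k)^-1)%G = ((L :&: K :^ x^-1) :^ l^-1)%G.
  apply: val_inj; rewrite /= conjIg (conjGid (groupVr Ll)) -conjsgM.
  by rewrite -invMg (invMg (l * x)%g) conjsgM (conjGid (groupVr Kk)).
have elx : (L :&: K :^ (l * x * k)^-1)%G = ((L :^ x :&: K) :^ (l * x)^-1)%G.
  by rewrite eA; apply: val_inj; rewrite /= invMg conjsgM !conjIg conjsgK.
rewrite -(ind_conj_sub (subsetIl L _) (subsetIl L _) eA _ Ll).
rewrite (cnj_comp mm _ _ elx) -(cnj_comp mm eB elx).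
by rewrite (cnj_res mm _ (subsetIr _ _) eB eK) (cnj_id mm eK).
Qed.

(** The Mackey formula as an average over all elements of [H]: the double coset
    of [x] has [#|L| * #|K| / #|L :&: K :^ x^-1|] elements. *)
Lemma mackey_averaged K L H (sKH : K \subset H) (sLH : L \subset H) (y : M K) :
  res mm sLH (ind mm sKH y) *+ (#|L| * #|K|) =
    \sum_(x in H) mackey_term L y x *+ #|(L :&: K :^ x^-1)%G|.
Proof.
rewrite mackey_formula -(sum_double_cosets sLH sKH) => [|l x k Ll _ Kk].
  rewrite -sumrMnl; apply: eq_bigr => D DD /=.
  by rewrite -(card_repr_double_coset DD) mulnC mulrnA.
rewrite mackey_term_double_coset //; congr (_ *+ _).
rewrite -[RHS](cardJg _ l^-1) /= conjIg (conjGid (groupVr Ll)) -conjsgM.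
by rewrite -invMg (invMg (l * x)%g) conjsgM (conjGid (groupVr Kk)).
Qed.

(** Restriction and induction, extended by zero to pairs of subgroups that are
    not nested, so that they can be summed over all subgroups. *)
Definition tres K H (m : M H) : M K :=
  if pselect (K \subset H) is left s then res mm s m else 0.
Definition tind K H (m : M K) : M H :=
  if pselect (K \subset H) is left s then ind mm s m else 0.

Lemma tresE K H (s : K \subset H) m : tres K m = res mm s m.
Proof.
by rewrite /tres; case: pselect => // s'; rewrite (eq_irrelevance s s').
Qed.
Lemma tres0 K H m : ~~ (K \subset H) -> tres K (m : M H) = 0.
Proof. by move=> /negP nKH; rewrite /tres; case: pselect. Qed.
Lemma tindE K H (s : K \subset H) m : tind H m = ind mm s m.
Proof.
by rewrite /tind; case: pselect => // s'; rewrite (eq_irrelevance s s').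
Qed.

Fact tres_is_zmod K H : zmod_morphism (@tres K H).
Proof.
by move=> u v; rewrite /tres; case: pselect => s; rewrite ?subr0 ?raddfB.
Qed.
HB.instance Definition _ K H :=
  GRing.isZmodMorphism.Build (M H) (M K) (@tres K H) (@tres_is_zmod K H).
Fact tind_is_zmod K H : zmod_morphism (@tind K H).
Proof.
by move=> u v; rewrite /tind; case: pselect => s; rewrite ?subr0 ?raddfB.
Qed.
HB.instance Definition _ K H :=
  GRing.isZmodMorphism.Build (M K) (M H) (@tind K H) (@tind_is_zmod K H).

Inductive ind_span H (j : nat) : M H -> Prop :=
| IndSpan0 : ind_span j (0 : M H)
| IndSpanD K (s : K \subset H) (y : M K) m :
    (#|K| <= j)%N -> ind_span j m -> ind_span j (ind mm s y + m).

Lemma ind_span_gen H j K (s : K \subset H) (y : M K) :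
  (#|K| <= j)%N -> ind_span j (ind mm s y).
Proof.
by move=> Kj; rewrite -[ind _ _ _]addr0; apply: IndSpanD (IndSpan0 _ _).
Qed.

Lemma ind_spanD H j (u v : M H) :
  ind_span j u -> ind_span j v -> ind_span j (u + v).
Proof.
elim=> [|K s y m Kj _ IH] jv; rewrite ?add0r // -addrA.
by apply: IndSpanD => //; exact: IH.
Qed.

Lemma ind_spanN H j (u : M H) : ind_span j u -> ind_span j (- u).
Proof.
elim=> [|K s y m Kj _ IH]; first by rewrite oppr0; exact: IndSpan0.
by rewrite opprD -raddfN; exact: IndSpanD.
Qed.

Lemma ind_span_sum H j (I : Type) (r : seq I) (P : pred I) (F : I -> M H) :
  (forall i, P i -> ind_span j (F i)) -> ind_span j (\sum_(i <- r | P i) F i).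
Proof.
move=> FP; elim/big_rec: _ => [|i x Pi]; first exact: IndSpan0.
by apply: ind_spanD; exact: FP.
Qed.

Lemma ind_spanMn H j n (u : M H) : ind_span j u -> ind_span j (u *+ n).
Proof.
move=> ju; elim: n => [|n IH]; first exact: IndSpan0.
by rewrite mulrS; exact: ind_spanD.
Qed.

Lemma ind_spanW H i j (u : M H) :
  (i <= j)%N -> ind_span i u -> ind_span j u.
Proof.
move=> ij; elim=> [|K s y m Ki _ IH]; first exact: IndSpan0.
by apply: IndSpanD => //; exact: leq_trans ij.
Qed.

Lemma ind_span_brauer H (m : M H) :
  m \in brauer_sub mm H -> ind_span #|H|.-1 m.
Proof.
case/brauer_subP=> y ->; apply: ind_span_sum => K _; apply: ind_span_gen.
by rewrite -ltnS prednK ?cardG_gt0 // proper_card // (valP K).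
Qed.

Lemma ind_span_mackey_term K L H (sLH : L \subset H) (y : M K) x :
  ind_span #|(L :&: K :^ x^-1)%G| (ind mm sLH (mackey_term L y x)).
Proof.
have s : (L :&: K :^ x^-1)%G \subset H.
  by apply: subset_trans sLH; exact: subsetIl.
by rewrite (ind_trans mm _ _ s); exact: ind_span_gen.
Qed.

(** The terms of the Mackey formula that survive in the graded pieces. *)
Lemma ind_mackey_term_conj K L H (sLH : L \subset H) (sKH : K \subset H)
    (y : M K) x : x \in H -> L = (K :^ x^-1)%G ->
  ind mm sLH (mackey_term L y x) = ind mm sKH y.
Proof.
move=> Hx LE; have s : (L :&: K :^ x^-1)%G \subset H.
  by apply: subset_trans sLH; exact: subsetIl.
have e : (L :^ x :&: K)%G = K.
  by apply: val_inj; rewrite /= LE /= conjsgKV setIid.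
have s' : (L :^ x :&: K)%G \subset H by rewrite e.
rewrite (ind_trans mm _ _ s) (ind_conj_sub s') //.
suff resE (A : {group gT}) (sAK : A \subset K) (sAH : A \subset H) :
  A = K -> ind mm sAH (res mm sAK y) = ind mm sKH y by exact: resE.
move=> AK; move: sAK sAH; rewrite AK => sKK sKH'.
by rewrite res_id (eq_irrelevance sKH' sKH).
Qed.

Definition level H j (m : M H) : M H :=
  \sum_(L : {group gT} | (L \subset H) && (#|L| == j)) tind H (tres L m).

Lemma levelD H j (u v : M H) : level j (u + v) = level j u + level j v.
Proof.
by rewrite /level -big_split; apply: eq_bigr => L _; rewrite !raddfD.
Qed.

(** On the quotient of [ind_span j.+1] by [ind_span j], the operator [level]
    is multiplication by [#|H| / j.+1].  Applied to an element induced from a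
    subgroup [K] of order [j.+1], the Mackey formula for [L] of the same order
    only keeps, modulo [ind_span j], the [x] with [L = K :^ x^-1], and every [x]
    in [H] occurs for exactly one [L].  Denominators are cleared by the factor [j.+1 * j.+1]. *)
Lemma ind_span_level H j (m : M H) : ind_span j.+1 m ->
  ind_span j (m *+ (#|H| * j.+1) - level j.+1 m *+ (j.+1 * j.+1)).
Proof.
elim=> [|K s y {}m Kj _ IH].
  rewrite /level big1 => [|L _]; last by rewrite !raddf0.
  by rewrite !mul0rn subr0; exact: IndSpan0.
rewrite levelD !mulrnDl opprD addrACA; apply: ind_spanD => {IH m}//.
move: Kj; rewrite leq_eqVlt => /orP[/eqP Kj|]; last first.
  rewrite ltnS => Kj; apply: ind_spanD; first exact/ind_spanMn/ind_span_gen.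
  apply/ind_spanN/ind_spanMn/ind_span_sum => L /andP[sLH _].
  rewrite (tindE sLH) (tresE sLH) mackey_formula raddf_sum.
  apply: ind_span_sum => D _ /=.
  apply: ind_spanW (ind_span_mackey_term sLH y (repr D)).
  apply: leq_trans Kj; rewrite -(cardJg K (repr D)^-1).
  by rewrite subset_leq_card ?subsetIr.
rewrite /level -sumrMnl.
have E (L : {group gT}) : (L \subset H) && (#|L| == j.+1) ->
    tind H (tres L (ind mm s y)) *+ (j.+1 * j.+1) =
    \sum_(x in H) tind H (mackey_term L y x) *+ #|(L :&: K :^ x^-1)%G|.
  case/andP=> sLH /eqP Lj; rewrite (tindE sLH) (tresE sLH) -{1}Lj -Kj -raddfMn.
  rewrite mackey_averaged raddf_sum; apply: eq_bigr => x _.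
  by rewrite raddfMn (tindE sLH).
rewrite (eq_bigr _ E) exchange_big /= mulnC mulrnA -sumr_const -sumrB.
apply: ind_span_sum => x Hx.
have sxH : (K :^ x^-1)%G \subset H by rewrite -(conjGid (groupVr Hx)) conjSg.
rewrite (bigD1 (K :^ x^-1)%G) /=; last by rewrite sxH cardJg Kj eqxx.
rewrite (tindE sxH) (ind_mackey_term_conj sxH s) //= setIid cardJg Kj.
rewrite opprD addrA subrr sub0r; apply/ind_spanN/ind_span_sum => L.
case/andP=> /andP[sLH /eqP Lj] LK; rewrite (tindE sLH); apply: ind_spanMn.
apply: ind_spanW (ind_span_mackey_term sLH y x).
rewrite -ltnS -Lj proper_card // properE subsetIl /=.
apply: contraNN LK => /subsetIP[_ sLK]; apply/eqP/val_inj/eqP => /=.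
by rewrite eqEcard sLK cardJg Kj Lj /=.
Qed.

Lemma ind_span_ndvd H j (m : M H) : ~~ (j.+1 %| #|H|)%N ->
  ind_span j.+1 m -> ind_span j m.
Proof.
move=> jH; elim=> [|K s y {}m Kj _ IH]; first exact: IndSpan0.
apply: IndSpanD => //; rewrite -ltnS ltn_neqAle Kj andbT.
by apply: contraNneq jH => <-; exact: cardSg.
Qed.

(** Multiplication by [#|H| * j.+1] moves the element from [ind_span j.+1] to
    [ind_span j], as [level] kills it; orders [j.+1] that do not divide [#|H|]
    do not contribute to the filtration. *)
Lemma brauer_sub_res_eq0 N H (m : M H) : (#|H| %| N)%N -> uniq_div N (M H) ->
  m \in brauer_sub mm H ->
  (forall K (s : K \subset H), K \proper H -> res mm s m = 0) -> m = 0.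
Proof.
move=> HN dH /ind_span_brauer.
have: (#|H|.-1 < #|H|)%N by rewrite prednK ?cardG_gt0.
elim: _.-1 m => [m _ []// K s y m' K0 | j IH m jH mj m0].
  by rewrite leqNgt cardG_gt0 in K0.
have [jdH|jndH] := boolP (j.+1 %| #|H|)%N; last first.
  by apply: IH m0 => //; [exact: ltnW | exact: ind_span_ndvd].
have dvN n : (n %| #|H|)%N -> injective (fun v : M H => v *+ n).
  by move=> nH; apply: mulrn_inj_div dH _; exact: dvdn_trans HN.
apply: (dvN _ (dvdnn _)); apply: (dvN _ jdH) => /=.
rewrite !mul0rn -mulrnA; apply: IH; first exact: ltnW.
  have := ind_span_level mj; rewrite /level big1 ?mul0rn ?subr0 // => L.
  case/andP=> sLH /eqP Lj; rewrite (tresE sLH) m0 ?raddf0 //.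
  by rewrite properEcard sLH Lj.
by move=> K s pK; rewrite raddfMn m0 ?mul0rn.
Qed.

(** * Marks *)

(** The restriction of [m] to [g H g^-1], carried back to [M H] by conjugation
    with [g^-1], and zero if [g H g^-1] is not a subgroup of [H'].  Carrying it
    back keeps [g] out of the type. *)
Definition mark H' (m : M H') H (g : gT) : M H :=
  tres H (cnj mm (erefl : (H' :^ g^-1^-1)%G = (H' :^ g^-1^-1)%G) m).

Lemma markE H' (m : M H') H (g : gT) K (e : K = (H' :^ g^-1^-1)%G) :
  mark m H g = tres H (cnj mm e m).
Proof. by subst K. Qed.

Lemma mark0 H' (m : M H') H (g : gT) : ~~ (H \subset H' :^ g) -> mark m H g = 0.
Proof. by move=> nH; rewrite /mark tres0 //= invgK. Qed.

Lemma mark_cnj H' K (x : gT) (e : K = (H' :^ x^-1)%G) (m : M H') H g :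
  mark (cnj mm e m) H g = mark m H (x^-1 * g)%g.
Proof.
have e' : (K :^ g^-1^-1)%G = (H' :^ (x^-1 * g)^-1^-1)%G.
  by rewrite e; apply: val_inj; rewrite /= !invgK conjsgM.
have e'' : (K :^ g^-1^-1)%G = (H' :^ (g^-1 * x)^-1)%G.
  by rewrite e' invMg invgK.
rewrite (markE _ _ e') /mark (cnj_comp mm _ _ e''); congr tres.
by apply: cnj_eq; rewrite invMg invgK.
Qed.

Lemma mark_in H' (m : M H') H h g : h \in H' -> mark m H (h * g)%g = mark m H g.
Proof.
move=> Hh; have e : H' = (H' :^ h^-1^-1)%G.
  by apply: val_inj; rewrite /= invgK conjGid.
by rewrite -{1}[h]invgK -(mark_cnj e) cnj_id // groupV.
Qed.

Lemma mark_res L H' (s : L \subset H') (m : M H') H g :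
  mark (res mm s m) H g = if H \subset L :^ g then mark m H g else 0.
Proof.
case: ifPn => [sH|]; last exact: mark0.
have sL : (L :^ g^-1^-1)%G \subset (H' :^ g^-1^-1)%G by rewrite /= conjSg.
have s' : H \subset (L :^ g^-1^-1)%G by rewrite /= invgK.
rewrite /mark (cnj_res mm s sL erefl erefl).
rewrite (tresE s') (tresE (subset_trans s' sL)).
exact: res_trans.
Qed.

Lemma mark_norm H' (m : M H') H n g : n \in 'N(H)%g ->
  mark m H (g * n^-1)%g = wcnj mm (coset H n) (mark m H g).
Proof.
move=> Nn; have e : H = (H :^ n^-1)%G.
  by apply: val_inj; rewrite /= (normP _) // groupV.
rewrite (wcnjE mm e) //.
have e' : (H' :^ (g * n^-1)^-1^-1)%G = ((H' :^ g^-1^-1) :^ n^-1)%G.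
  by apply: val_inj; rewrite /= !invgK conjsgM.
have e'' : (H' :^ (g * n^-1)^-1^-1)%G = (H' :^ (n * g^-1)^-1)%G.
  by apply: val_inj; rewrite /= !invMg !invgK.
have eg : (n * g^-1)%g = (g * n^-1)^-1%g by rewrite invMg invgK.
have [s|ns] := boolP (H \subset H' :^ g); last first.
  rewrite [mark m H g]mark0 // raddf0 mark0 //; apply: contra ns.
  by rewrite conjsgM -(conjSg _ _ n) conjsgKV (normP Nn).
have s1 : H \subset (H' :^ g^-1^-1)%G by rewrite /= invgK.
have s2 : H \subset (H' :^ (g * n^-1)^-1^-1)%G.
  by rewrite e' {1}e /= conjSg invgK.
rewrite /mark (tresE s1) (tresE s2) (cnj_res mm s1 s2 e e').
by rewrite (cnj_comp mm _ _ e''); congr (res mm _ _); exact: cnj_eq.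
Qed.

Lemma mark_id H (m : M H) : mark m H 1 = m.
Proof.
have e : H = (H :^ 1^-1^-1)%G by apply: val_inj; rewrite /= !invg1 conjsg1.
by rewrite (markE _ _ e) (tresE (subxx H)) res_id cnj_id // invg1.
Qed.

Lemma mackey_term_mark K H (y : M K) x :
  mackey_term H y x *+ #|(H :&: K :^ x^-1)%G| - mark y H x^-1 *+ #|H|
    \in brauer_sub mm H.
Proof.
have [sH|nsH] := boolP (H \subset K :^ x^-1); last first.
  rewrite mark0 // mul0rn subr0 rpredMn // brauer_sub_ind //.
  by rewrite properE subsetIl subsetI subxx.
have eA : (H :&: K :^ x^-1)%G = H by apply: val_inj; exact/setIidPl.
have eK : (K :^ x^-1^-1^-1)%G = (K :^ x^-1)%G by rewrite invgK.
have s1 : (H :&: K :^ x^-1)%G \subset (K :^ x^-1^-1^-1)%G.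
  by rewrite eK subsetIr.
have s2 : H \subset (K :^ x^-1^-1^-1)%G by rewrite eK.
have -> : mark y H x^-1 = mackey_term H y x; last first.
  by rewrite eA subrr rpred0.
rewrite /mackey_term (cnj_res mm _ s1 _ eK) (markE _ _ erefl) (tresE s2).
have -> : cnj mm erefl y = cnj mm eK y by apply: cnj_eq; rewrite invgK.
suff indE (A : {group gT}) (sA : A \subset H) (s : A \subset _) z : A = H ->
  ind mm sA (res mm s z) = res mm s2 z by rewrite indE.
move=> AH; move: sA s; rewrite AH => sA s.
by rewrite ind_id (eq_irrelevance s s2).
Qed.

(** Modulo images of induction from proper subgroups of [H], only the terms of
    the Mackey formula with [H] contained in the conjugate of [K] survive. *)
Lemma mark_ind K H' (s : K \subset H') (y : M K) H g :
  (mark (ind mm s y) H g *+ #|K| - \sum_(x in H') mark y H (x^-1 * g)%g) *+ #|H|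
    \in brauer_sub mm H.
Proof.
have [sH|nsH] := boolP (H \subset H' :^ g); last first.
  rewrite mark0 // mul0rn big1 ?subr0 ?mul0rn ?rpred0 // => x Hx.
  apply: mark0; apply: contra nsH => /subset_trans -> //.
  by rewrite conjsgM conjSg -(conjGid (groupVr Hx)) conjSg.
set K' := (K :^ g^-1^-1)%G; set H'' := (H' :^ g^-1^-1)%G.
pose y' : M K' := cnj mm erefl y.
have s' : K' \subset H'' by rewrite /= conjSg.
have sH' : H \subset H'' by rewrite /= invgK.
have -> : mark (ind mm s y) H g = res mm sH' (ind mm s' y').
  by rewrite /mark (cnj_ind mm s s' erefl) (tresE sH').
have -> : \sum_(x in H') mark y H (x^-1 * g)%g =
          \sum_(x in H'') mark y' H x^-1.
  rewrite (reindex_inj (conjg_inj g^-1%g)); apply: eq_big => x /=.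
    by rewrite /H'' /= invgK mem_conjg.
  by move=> _; rewrite mark_cnj /conjg !(invMg, invgK) mulgKV.
rewrite mulrnBl -mulrnA mulnC -(cardJg K g^-1^-1%g) mackey_averaged.
rewrite -sumrMnl -sumrB.
by apply: rpred_sum => x _; exact: mackey_term_mark.
Qed.

End MackeyTheory.

Section MarkRing.
Variables (gT : finGroupType) (R : green gT).
Implicit Types (H K : {group gT}).

Lemma mark_ringM H' (a b : R H') H g :
  mark (gr_mackey R) (a * b) H g =
  mark (gr_mackey R) a H g * mark (gr_mackey R) b H g.
Proof.
rewrite /mark gr_cnjM /tres; case: pselect => s; last by rewrite mulr0.
by rewrite gr_resM.
Qed.

Lemma mark_ring1 H' H g :
  H \subset H' :^ g -> mark (gr_mackey R) (1 : R H') H g = 1.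
Proof.
move=> sH; have s : H \subset (H' :^ g^-1^-1)%G by rewrite /= invgK.
by rewrite /mark gr_cnj1 (tresE _ s) gr_res1.
Qed.

Lemma mark_modZ (M : green_mod R) H' (a : R H') (m : M H') H g :
  mark (gm_mackey M) (a *: m) H g =
  mark (gr_mackey R) a H g *: mark (gm_mackey M) m H g.
Proof.
rewrite /mark gm_cnjZ /tres; case: pselect => s; last by rewrite scaler0.
by rewrite gm_resZ.
Qed.

Lemma mark_gh (M N : green_mod R) (f : green_hom M N) H' (m : M H') H g :
  gh f H (mark (gm_mackey M) m H g) = mark (gm_mackey N) (gh f H' m) H g.
Proof.
rewrite /mark -gh_cnj /tres; case: pselect => s; first by rewrite gh_res.
have := gh_lin f H (-1) 0 0; rewrite scaler0 addr0 => ->.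
by rewrite scaleN1r addNr.
Qed.

End MarkRing.

(** * Modules over the skew group ring *)

Section SkewModule.
Variables (gT : finGroupType) (R : green gT) (H : {group gT}).
Variable V : lmodType (brauer_skew R H).

Local Notation elt := (skew_elt (brauer_ract R H)).

(** The module structure over [R H] and the semilinear action of the normalizer
    of [H] that encode a module over the skew group ring. *)
Definition rscale (a : R H) (v : V) : V := elt (bring_pi a) 1%g *: v.
Definition wact (n : gT) (v : V) : V := elt 1 (coset H n) *: v.

Fact rscale_is_zmod a : zmod_morphism (rscale a).
Proof. by move=> u v; rewrite /rscale scalerBr. Qed.
HB.instance Definition _ a :=
  GRing.isZmodMorphism.Build V V (rscale a) (rscale_is_zmod a).
Fact wact_is_zmod n : zmod_morphism (wact n).
Proof. by move=> u v; rewrite /wact scalerBr. Qed.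
HB.instance Definition _ n :=
  GRing.isZmodMorphism.Build V V (wact n) (wact_is_zmod n).

Lemma rscaleD a b v : rscale (a + b) v = rscale a v + rscale b v.
Proof.
rewrite /rscale -scalerDl; congr (_ *: v); apply: skew_funP => x.
rewrite skew_funD !skew_fun_elt; case: ifP => _; last by rewrite addr0.
exact: rq_piD.
Qed.

Lemma rscaleM a b v : rscale (a * b) v = rscale a (rscale b v).
Proof.
rewrite /rscale scalerA skew_eltM ract1 mulg1; congr (elt _ _ *: v).
exact: rq_piM.
Qed.

Lemma rscale1 v : rscale 1 v = v.
Proof. exact: scale1r. Qed.

Lemma rscale_brauer a v : a \in brauer_sub (gr_mackey R) H -> rscale a v = 0.
Proof.
move=> Ia; have e : bring_pi a = bring_pi 0.
  by apply/(rq_eqP (@bring_l _ R H) (@bring_r _ R H)); rewrite subr0.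
rewrite /rscale e; apply: (addIr (rscale 0 v)).
by rewrite -[LHS]rscaleD !add0r.
Qed.

Lemma wact_in n v : n \in H -> wact n v = v.
Proof. by move=> Hn; rewrite /wact coset_id // scale1r. Qed.

Lemma wactM m n v : m \in 'N(H)%g -> n \in 'N(H)%g ->
  wact (m * n)%g v = wact m (wact n v).
Proof.
by move=> Nm Nn; rewrite /wact scalerA skew_eltM ract_one mul1r morphM.
Qed.

Lemma wact_rscale n a v :
  wact n (rscale a v) = rscale (wcnj (gr_mackey R) (coset H n) a) (wact n v).
Proof.
rewrite /wact /rscale !scalerA !skew_eltM ract_one !mulr1 mul1r mul1g mulg1.
by rewrite /= bring_cnjE.
Qed.

End SkewModule.

(** * The inverse functor on objects *)

Section Ghost.
Variables (gT : finGroupType) (R : green gT) (T : {set {group gT}}).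
Local Notation rep := {H : {group gT} | H \in T}.
Variable V : forall H : rep, lmodType (brauer_skew R (val H)).
Implicit Types (H : rep) (A B C : {group gT}).

(** A family of elements indexed by all subgroups, the conjugates [g H g^-1] of
    the members of [T]: [f H g] in [V H] stands for its component at
    [g H g^-1], carried back to [V H] by conjugation with [g^-1].  In this form
    no module has to be transported along an equality of subgroups. *)
Definition gfun : Type := forall H : rep, gT -> V H.

HB.instance Definition _ := gen_eqMixin gfun.
HB.instance Definition _ := gen_choiceMixin gfun.

Lemma gfunP (f f' : gfun) : (forall H g, f H g = f' H g) -> f = f'.
Proof.
by move=> ff; apply: functional_extensionality_dep => H; apply/funext => g.
Qed.

Definition gfun_add (f f' : gfun) : gfun := fun H g => f H g + f' H g.
Definition gfun_zero : gfun := fun H g => 0.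
Definition gfun_opp (f : gfun) : gfun := fun H g => - f H g.

Fact gfun_addA : associative gfun_add.
Proof. by move=> f1 f2 f3; apply: gfunP => H g; exact: addrA. Qed.
Fact gfun_addC : commutative gfun_add.
Proof. by move=> f1 f2; apply: gfunP => H g; exact: addrC. Qed.
Fact gfun_add0 : left_id gfun_zero gfun_add.
Proof. by move=> f; apply: gfunP => H g; exact: add0r. Qed.
Fact gfun_addN : left_inverse gfun_zero gfun_opp gfun_add.
Proof. by move=> f; apply: gfunP => H g; exact: addNr. Qed.

HB.instance Definition _ := GRing.isZmodule.Build gfun
  gfun_addA gfun_addC gfun_add0 gfun_addN.

Lemma gfunB (f f' : gfun) H g : (f - f') H g = f H g - f' H g.
Proof. by []. Qed.

(** The families that are compatible with the different ways of writing a
    subgroup as [g H g^-1], supported on the subgroups of [A], and invariant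
    under [A]. *)
Definition ghost_pred A : {pred gfun} := fun f : gfun => `[<
    [/\ forall H n g, n \in 'N(val H)%g -> f H (g * n^-1)%g = wact n (f H g),
        forall H g, ~~ (val H \subset A :^ g) -> f H g = 0 &
        forall H h g, h \in A -> f H (h * g)%g = f H g] >].

Lemma ghostP A (f : gfun) :
  reflect
    [/\ forall H n g, n \in 'N(val H)%g -> f H (g * n^-1)%g = wact n (f H g),
        forall H g, ~~ (val H \subset A :^ g) -> f H g = 0 &
        forall H h g, h \in A -> f H (h * g)%g = f H g]
    (f \in ghost_pred A).
Proof. exact: asboolP. Qed.

Fact ghost_pred_zmod A : zmod_closed (@ghost_pred A).
Proof.
split=> [|f f' /ghostP[fN f0 fA] /ghostP[f'N f'0 f'A]]; apply/ghostP.
  by split=> // H n g _; rewrite raddf0.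
split=> [H n g Nn|H g Hg|H h g Ah]; rewrite !gfunB.
- by rewrite fN // f'N // raddfB.
- by rewrite f0 // f'0 // subr0.
- by rewrite fA // f'A.
Qed.
HB.instance Definition _ A :=
  GRing.isZmodClosed.Build gfun (@ghost_pred A) (ghost_pred_zmod A).

Record ghost A := Ghost { ghost_fun : gfun; _ : ghost_fun \in ghost_pred A }.
HB.instance Definition _ A := [isSub for @ghost_fun A].
HB.instance Definition _ A := [Choice of ghost A by <:].
HB.instance Definition _ A := [SubChoice_isSubZmodule of ghost A by <:].

Lemma ghost_eqP A (f f' : ghost A) :
  (forall H g, ghost_fun f H g = ghost_fun f' H g) -> f = f'.
Proof. by move=> ff; apply: val_inj; exact: gfunP. Qed.

Lemma ghost_norm A (f : ghost A) H n g :
  n \in 'N(val H)%g -> ghost_fun f H (g * n^-1)%g = wact n (ghost_fun f H g).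
Proof. by case/ghostP: (valP f) => + _ _; apply. Qed.
Lemma ghost_supp A (f : ghost A) H g :
  ~~ (val H \subset A :^ g) -> ghost_fun f H g = 0.
Proof. by case/ghostP: (valP f) => _ + _; apply. Qed.
Lemma ghost_inv A (f : ghost A) H h g :
  h \in A -> ghost_fun f H (h * g)%g = ghost_fun f H g.
Proof. by case/ghostP: (valP f) => _ _; apply. Qed.

Definition gscale A (r : R A) (f : gfun) : gfun :=
  fun H g => rscale (mark (gr_mackey R) r (val H) g) (f H g).

Fact ghost_scale_proof A (r : R A) (f : ghost A) :
  gscale r (ghost_fun f) \in ghost_pred A.
Proof.
apply/ghostP; split=> [H n g Nn|H g Hg|H h g Ah]; rewrite /gscale.
- by rewrite ghost_norm // mark_norm // wact_rscale.
- by rewrite ghost_supp // raddf0.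
- by rewrite ghost_inv // mark_in.
Qed.
Definition ghost_scale A (r : R A) (f : ghost A) :=
  Ghost (ghost_scale_proof r f).

Lemma ghost_scaleE A (r : R A) (f : ghost A) H g :
  ghost_fun (ghost_scale r f) H g =
  rscale (mark (gr_mackey R) r (val H) g) (ghost_fun f H g).
Proof. by []. Qed.
Lemma ghostD A (f f' : ghost A) H g :
  ghost_fun (f + f') H g = ghost_fun f H g + ghost_fun f' H g.
Proof. by []. Qed.

Fact ghost_scaleA A a b (v : ghost A) :
  ghost_scale a (ghost_scale b v) = ghost_scale (a * b) v.
Proof.
by apply: ghost_eqP => H g; rewrite !ghost_scaleE mark_ringM rscaleM.
Qed.
Fact ghost_scale1 A : left_id 1 (@ghost_scale A).
Proof.
move=> v; apply: ghost_eqP => H g; rewrite ghost_scaleE.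
have [s|s] := boolP (val H \subset A :^ g); last by rewrite ghost_supp ?raddf0.
by rewrite mark_ring1 // rscale1.
Qed.
Fact ghost_scaleDr A : right_distributive (@ghost_scale A) +%R.
Proof.
move=> a u v; apply: ghost_eqP => H g.
by rewrite ghostD !ghost_scaleE ghostD raddfD.
Qed.
Fact ghost_scaleDl A v : {morph (@ghost_scale A)^~ v : a b / a + b}.
Proof.
move=> a b; apply: ghost_eqP => H g; rewrite ghostD !ghost_scaleE -rscaleD.
by congr rscale; rewrite /mark !raddfD.
Qed.
HB.instance Definition _ A := GRing.Zmodule_isLmodule.Build (R A) (ghost A)
  (@ghost_scaleA A) (@ghost_scale1 A) (@ghost_scaleDr A) (@ghost_scaleDl A).

Lemma ghost_sum A (I : Type) (r : seq I) (P : pred I) (F : I -> ghost A) H g :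
  ghost_fun (\sum_(i <- r | P i) F i) H g =
  \sum_(i <- r | P i) ghost_fun (F i) H g.
Proof. by elim/big_rec2: _ => // i u v _ <-. Qed.
Lemma ghostB A (f f' : ghost A) H g :
  ghost_fun (f - f') H g = ghost_fun f H g - ghost_fun f' H g.
Proof. by []. Qed.
Lemma ghostMn A (f : ghost A) n H g :
  ghost_fun (f *+ n) H g = ghost_fun f H g *+ n.
Proof. by elim: n => // n IH; rewrite !mulrS ghostD IH. Qed.
Lemma ghostZ A (r : R A) (f : ghost A) H g :
  ghost_fun (r *: f) H g =
  rscale (mark (gr_mackey R) r (val H) g) (ghost_fun f H g).
Proof. by []. Qed.

Fact gcnj_proof (x : gT) A B (e : B = (A :^ x^-1)%G) (f : ghost A) :
  ((fun H g => ghost_fun f H (x^-1 * g)%g) : gfun) \in ghost_pred B.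
Proof.
subst B; apply/ghostP; split=> [H n g Nn|H g Hg|H h g Bh].
- by rewrite mulgA ghost_norm.
- by apply: ghost_supp; rewrite conjsgM.
- rewrite -[RHS](ghost_inv f H (h := (h ^ x)%g)); last first.
    by rewrite -mem_conjgV.
  by rewrite conjgE !mulgA mulgK.
Qed.
Definition gcnj x A B e f : ghost B := Ghost (@gcnj_proof x A B e f).
Lemma gcnjE x A B e f H g :
  ghost_fun (@gcnj x A B e f) H g = ghost_fun f H (x^-1 * g)%g.
Proof. by []. Qed.
Fact gcnj_is_zmod x A B e : zmod_morphism (@gcnj x A B e).
Proof. by move=> u v; apply: ghost_eqP. Qed.
HB.instance Definition _ x A B e :=
  GRing.isZmodMorphism.Build (ghost A) (ghost B) (@gcnj x A B e)
    (@gcnj_is_zmod x A B e).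

Fact gres_proof A B (s : A \subset B) (f : ghost B) :
  ((fun H g => if val H \subset A :^ g then ghost_fun f H g else 0) : gfun)
    \in ghost_pred A.
Proof.
apply/ghostP; split=> [H n g Nn|H g Hg|H h g Ah].
- rewrite ghost_norm // conjsgM -{1}(normP (groupVr Nn)) conjSg.
  by case: ifP => // _; rewrite raddf0.
- by rewrite (negPf Hg).
- by rewrite conjsgM (conjGid Ah) ghost_inv // (subsetP s).
Qed.
Definition gres A B s f : ghost A := Ghost (@gres_proof A B s f).
Lemma gresE A B s f H g : ghost_fun (@gres A B s f) H g =
  if val H \subset A :^ g then ghost_fun f H g else 0.
Proof. by []. Qed.
Fact gres_is_zmod A B s : zmod_morphism (@gres A B s).
Proof.
move=> u v; apply: ghost_eqP => H g; rewrite ghostB !gresE ghostB.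
by case: ifP; rewrite ?subr0.
Qed.
HB.instance Definition _ A B s :=
  GRing.isZmodMorphism.Build (ghost B) (ghost A) (@gres A B s)
    (@gres_is_zmod A B s).

Hypothesis dV : forall H, uniq_div #|gT| (V H).

Lemma gfun_eqMn n H (u v : V H) : (n %| #|gT|)%N -> u *+ n = v *+ n -> u = v.
Proof. by move=> nN; exact: (mulrn_inj_div (dV H) nN). Qed.

Lemma card_dvd A : (#|A| %| #|gT|)%N.
Proof. by rewrite -cardsT cardSg // subsetT. Qed.

Lemma ghost_uniq_div A : uniq_div #|gT| (ghost A).
Proof.
split=> [v v0|v].
  apply: ghost_eqP => H g; apply: (dV H).1.
  by rewrite -ghostMn v0.
pose w : gfun := fun H g => divn_by (dV H) (dvdnn _) (ghost_fun v H g).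
have wE H g : w H g *+ #|gT| = ghost_fun v H g by exact: divn_byK.
have wP : w \in ghost_pred A.
  apply/ghostP; split=> [H n g Nn|H g Hg|H h g Ah];
    apply: (gfun_eqMn (dvdnn _)).
  - by rewrite -raddfMn !wE ghost_norm.
  - by rewrite wE mul0rn ghost_supp.
  - by rewrite !wE ghost_inv.
by exists (Ghost wP); apply: ghost_eqP => H g; rewrite ghostMn wE.
Qed.

Fact gsum_proof A B (s : A \subset B) (f : ghost A) :
  ((fun H g => \sum_(x in B) ghost_fun f H (x^-1 * g)%g) : gfun)
    \in ghost_pred B.
Proof.
apply/ghostP; split=> [H n g Nn|H g Hg|H h g Bh].
- by rewrite raddf_sum; apply: eq_bigr => x Bx; rewrite mulgA ghost_norm.
- rewrite big1 // => x Bx; apply: ghost_supp.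
  apply: contra Hg => /subset_trans-> //.
  by rewrite conjsgM conjSg -(conjGid (groupVr Bx)) conjSg.
- rewrite (reindex_inj (mulgI h)); apply: eq_big => [x|x _].
    by rewrite groupMl.
  by rewrite invMg -mulgA mulKg.
Qed.

(** Induction is the trace from [A] to [B], written as the sum over [B] divided
    by [#|A|] so as to avoid coset representatives. *)
Definition gind A B s f : ghost B :=
  divn_by (ghost_uniq_div B) (card_dvd A) (Ghost (@gsum_proof A B s f)).
Lemma gindE A B s f H g : ghost_fun (@gind A B s f) H g *+ #|A| =
  \sum_(x in B) ghost_fun f H (x^-1 * g)%g.
Proof. by rewrite -ghostMn divn_byK. Qed.

Lemma gind_uniq A B s f (w : ghost B) :
  (forall H g, ghost_fun w H g *+ #|A| =
               \sum_(x in B) ghost_fun f H (x^-1 * g)%g) ->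
  @gind A B s f = w.
Proof.
move=> wE; apply: ghost_eqP => H g; apply: (gfun_eqMn (card_dvd A)).
by rewrite wE gindE.
Qed.

Arguments gind : simpl never.
Fact gind_is_zmod A B s : zmod_morphism (@gind A B s).
Proof.
move=> u v; apply: gind_uniq => H g; rewrite ghostB mulrnBl !gindE -sumrB.
by apply: eq_bigr => x _.
Qed.
HB.instance Definition _ A B s :=
  GRing.isZmodMorphism.Build (ghost A) (ghost B) (@gind A B s)
    (@gind_is_zmod A B s).

Definition ghost_mackey : mackey (fun A => ghost A : zmodType).
Proof.
refine (@MackeyStruct _ _ (fun A B s => gres s : {additive _ -> _})
  (fun A B s => gind s : {additive _ -> _})
  (fun x A B e => gcnj e : {additive _ -> _}) _ _ _ _ _ _ _ _ _).
- move=> A s f; apply: ghost_eqP => H g; rewrite gresE.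
  by case: ifPn => // nH; rewrite ghost_supp.
- move=> A s f; apply: gind_uniq => H g.
  rewrite -sumr_const; apply: eq_bigr => x Ax.
  by rewrite ghost_inv ?groupV.
- move=> A B C sAB sBC sAC f; apply: ghost_eqP => H g; rewrite !gresE.
  case: ifP => // sH; rewrite (subset_trans sH) //.
  by rewrite conjSg.
- move=> A B C sAB sBC sAC f; apply/esym; apply: gind_uniq => H g.
  apply: (gfun_eqMn (card_dvd B)); rewrite mulrnAC gindE -sumrMnl.
  under eq_bigr => x Cx do rewrite gindE.
  rewrite exchange_big -sumr_const; apply: eq_bigr => y By /=.
  rewrite (reindex_inj (mulIg y^-1%g)); apply: eq_big => [x|x _].
    by rewrite groupMr // groupV (subsetP sBC).
  by rewrite invMg invgK mulgA mulKg.
- move=> x y A B C e e' e'' f; apply: ghost_eqP => H g.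
  by rewrite !gcnjE invMg mulgA.
- move=> x A e f Ax; apply: ghost_eqP => H g.
  by rewrite gcnjE ghost_inv ?groupV.
- move=> x A B A' B' sAB sAB' eA eB f; apply: ghost_eqP => H g.
  rewrite gcnjE !gresE gcnjE; congr (if _ then _ else _).
  by rewrite eA conjsgM.
- move=> x A B A' B' sAB sAB' eA eB f; apply/esym; apply: gind_uniq => H g.
  have cA : #|A'| = #|A| by rewrite eA cardJg.
  rewrite gcnjE cA gindE [RHS](reindex_inj (conjg_inj x^-1%g)).
  apply: eq_big => [y|y _]; first by rewrite eB memJ_conjg.
  by rewrite gcnjE conjgE !(invMg, invgK) !mulgA mulVg mul1g.
(* Both sides of the Mackey formula, multiplied by [#|B| * #|A|], are sums over
   [C] and [B] of values of [f]. *)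
move=> A B C sAC sBC f; apply: ghost_eqP => H g /=.
pose F x := \sum_(y in B) if val H \subset B :^ g
                          then ghost_fun f H ((y * x)^-1 * g)%g else 0.
apply: (gfun_eqMn (card_dvd B)); apply: (gfun_eqMn (card_dvd A)).
rewrite ghost_sum -!mulrnA -sumrMnl.
rewrite [RHS](eq_bigr (fun D => F (repr D) *+ #|D|)) => [|D DD].
  rewrite (sum_double_cosets sBC sAC) => [|b x a Bb Cx Aa]; last first.
    rewrite /F (reindex_inj (mulIg b^-1%g)); apply: eq_big => [y|y _].
      by rewrite groupMr // groupV.
    case: ifP => // _; rewrite !invMg !invgK -!mulgA.
    by rewrite ghost_inv ?groupV //; congr (ghost_fun f H _); rewrite mulKg.
  rewrite /F exchange_big /= mulnC mulrnA -sumr_const; apply: eq_bigr => y By.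
  case: ifP => _; last by rewrite mul0rn big1.
  rewrite gindE (reindex_inj (mulgI y)) /=; apply: eq_bigl => x.
  by rewrite groupMl // (subsetP sBC).
rewrite -(card_repr_double_coset DD) mulnC mulrnA; congr (_ *+ _).
rewrite gindE; apply: eq_bigr => y By; rewrite gcnjE gresE invMg -mulgA.
rewrite /= conjIg -conjsgM mulKVg subsetI conjsgM (conjGid (groupVr By)).
by case: (_ \subset _) => //=; case: ifPn => // nH; rewrite ghost_supp.
Defined.

Definition ghost_mod : green_mod R.
Proof.
refine (@GreenMod _ R (fun A => ghost A : lmodType (R A)) ghost_mackey _ _ _ _).
- move=> A B s r f; apply: ghost_eqP => H g.
  rewrite gresE !ghostZ gresE mark_res.
  by case: ifP => // _; rewrite raddf0.
- move=> x A B e r f; apply: ghost_eqP => H g.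
  by rewrite gcnjE !ghostZ gcnjE mark_cnj.
- move=> A B s r f; apply: gind_uniq => H g.
  rewrite ghostZ -raddfMn gindE raddf_sum; apply: eq_bigr => x Bx.
  rewrite ghostZ mark_res; case: ifPn => [_|nH]; last first.
    by rewrite ghost_supp ?raddf0.
  by rewrite mark_in ?groupV.
- (* The classes of [mark_ind] act as zero on [V H], so that up to the factors
     [#|A|] and [#|H|] the marks of an induced element form a trace too. *)
  move=> A B s r f; apply: gind_uniq => H g; rewrite ghostZ.
  have [sc scE] := additive_pack (fun a b => rscaleD a b (ghost_fun f H g)).
  rewrite -scE -raddfMn; apply: (gfun_eqMn (card_dvd (val H))).
  have /(rscale_brauer (ghost_fun f H g)) :=
    mark_ind (gr_mackey R) s r (val H) g.
  rewrite -scE [sc ((_ - _) *+ _)]raddfMn raddfB mulrnBl => /eqP.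
  rewrite subr_eq0 => /eqP ->.
  rewrite raddf_sum; congr (_ *+ _); apply: eq_bigr => x Bx.
  rewrite scE ghostZ gresE; case: ifPn => nH.
    by rewrite ghost_inv ?groupV.
  by rewrite raddf0 mark0 // -scE raddf0.
Defined.

(** * Families as sums of induced components *)

Fact gdelta_proof A B (s : B \subset A) (f : ghost A) :
  ((fun H g => if val H == (B :^ g)%G then ghost_fun f H g else 0) : gfun)
    \in ghost_pred B.
Proof.
apply/ghostP; split=> [H n g Nn|H g Hg|H h g Bh].
- have -> : (val H == (B :^ (g * n^-1))%G) = (val H == (B :^ g)%G).
    rewrite -!val_eqE /= conjsgM -{1}(normP (groupVr Nn)).
    exact: (inj_eq (can_inj (conjsgKV n))).
  by rewrite ghost_norm //; case: ifP => // _; rewrite raddf0.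
- by case: ifP => // /eqP HE; rewrite HE subxx in Hg.
- rewrite ghost_inv ?(subsetP s) //.
  have -> // : (B :^ (h * g))%G = (B :^ g)%G.
  by apply: val_inj; rewrite /= conjsgM conjGid.
Qed.

Definition gdelta A B s f : ghost B := Ghost (@gdelta_proof A B s f).

Lemma gdeltaE A B s f H g : ghost_fun (@gdelta A B s f) H g =
  if val H == (B :^ g)%G then ghost_fun f H g else 0.
Proof. by []. Qed.

(** The term of [x] in the trace of the component at [B] is the component at
    [B :^ x^-1]; for each [x] in [A], every component occurs for exactly one
    [B]. *)
Lemma gdelta_decomp A (f : ghost A) :
  f *+ #|A| = \sum_(B : {group gT})
    (if pselect (B \subset A) is left s then gind s (gdelta s f) *+ #|B|
     else 0).
Proof.
apply: ghost_eqP => H g; rewrite ghostMn ghost_sum.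
pose F (B : {group gT}) x :=
  if val H == (B :^ (x^-1 * g))%G then ghost_fun f H g else 0.
rewrite [RHS](eq_bigr (fun B : {group gT} => \sum_(x in A) F B x)) => [|B _].
  rewrite exchange_big -sumr_const; apply: eq_bigr => x Ax /=.
  rewrite (bigD1 (val H :^ (g^-1 * x))%G) //= big1 => [|B BH].
    rewrite /F addr0 ifT //; apply/eqP/val_inj => /=.
    by rewrite -conjsgM -mulgA mulKVg mulVg conjsg1.
  rewrite /F; case: ifP => // /eqP HE; case/eqP: BH; apply: val_inj.
  by rewrite /= HE /= -conjsgM -mulgA mulKVg mulVg conjsg1.
case: pselect => [s|nBA].
  rewrite ghostMn gindE; apply: eq_bigr => x Ax.
  by rewrite /= /F ghost_inv // groupV.
rewrite big1 // => x Ax; rewrite /F; case: ifP => // /eqP HE.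
rewrite ghost_supp //; apply: contra_notN nBA => sH.
rewrite HE /= conjsgM conjSg in sH.
by rewrite -(conjSg _ _ x^-1%g) (conjGid (groupVr Ax)).
Qed.

Hypothesis T_inj : forall H H' (x : gT), val H = (val H' :^ x)%G -> H = H'.

(** Induction from a proper subgroup never reaches the component at [A];
    conversely a family without this component is a sum of induced components
    at proper subgroups, by [gdelta_decomp]. *)
Lemma ghost_brauer_sub A (f : ghost A) H g : A = (val H :^ g^-1)%G ->
  reflect (ghost_fun f H g = 0) (f \in brauer_sub ghost_mackey A).
Proof.
move=> AE; apply: (iffP idP) => [/brauer_subP[y ->]|f0].
  rewrite ghost_sum big1 // => B _; apply: (gfun_eqMn (card_dvd (val B))).
  rewrite gindE mul0rn big1 // => x Ax; apply: ghost_supp.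
  apply/negP=> /subset_leq_card; rewrite cardJg leqNgt => /negP; apply.
  have cA : #|A| = #|val H| by rewrite AE cardJg.
  by rewrite -cA proper_card // (valP B).
suff wP (w : ghost A) : ghost_fun w H g = 0 ->
    w *+ #|A| \in brauer_sub ghost_mackey A.
  have [w wE] := mulrn_surj_div (ghost_uniq_div A) (card_dvd A) f.
  rewrite -wE; apply: wP; apply: (gfun_eqMn (card_dvd A)).
  by rewrite -ghostMn wE f0 mul0rn.
move=> w0; rewrite gdelta_decomp; apply: rpred_sum => B _.
case: pselect => [s|_]; last exact: rpred0.
have [BA|nBA] := eqVneq B A; last first.
  apply: rpredMn.
  apply: (@brauer_sub_ind _ _ ghost_mackey B A s (gdelta s w)).
  rewrite properEneq s andbT.
  by apply: contraNneq nBA => BA; apply/eqP/val_inj.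
have -> : gdelta s w = 0; last by rewrite raddf0 mul0rn rpred0.
apply: ghost_eqP => H' g'; rewrite gdeltaE; case: ifP => // /eqP.
rewrite {}BA => HE.
have HH : H' = H.
  apply: (@T_inj _ _ (g^-1 * g')%g); rewrite HE AE; apply: val_inj => /=.
  by rewrite conjsgM.
rewrite {}HH in HE *.
(* [g] and [g'] conjugate [H] to the same group: they differ by an element of
   the normalizer. *)
have -> : g' = (g * (g'^-1 * g)^-1)%g.
  by rewrite invMg invgK mulgA mulgV mul1g.
rewrite ghost_norm ?w0 ?raddf0 // -groupV invMg invgK; apply/normP.
have := congr1 val HE; rewrite AE /= => {2}->.
by rewrite conjsgM.
Qed.

End Ghost.

(** * The inverse functor on morphisms *)

Section GhostMap.
Variables (gT : finGroupType) (R : green gT) (T : {set {group gT}}).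
Local Notation rep := {H : {group gT} | H \in T}.
Implicit Types (H : rep) (A B : {group gT}).

Lemma ghost_Qlocal (Q : subringClosed rat)
    (V : forall H : rep, lmodType (brauer_skew R (val H))) A :
  (forall H, Qlocal Q (V H)) -> Qlocal Q (ghost V A).
Proof.
move=> QV; pose act H := sval (cid (QV H)).
have actP H : Qact Q (act H) by rewrite /act; case: cid.
have actf q (f : ghost V A) : q \in Q ->
    ((fun H g => act H q (ghost_fun f H g)) : gfun V) \in ghost_pred A.
  move=> Qq; have act0 H : act H q 0 = 0.
    have [_ _ _ aD] := actP H; apply: (addIr (act H q 0)).
    by rewrite -aD // !add0r.
  apply/ghostP; split=> [H n g Nn|H g Hg|H h g Ah].
  - by rewrite ghost_norm // -(Qlocal_additive (actP H) (actP H) (wact n)).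
  - by rewrite ghost_supp ?act0.
  - by rewrite ghost_inv.
pose gact q (f : ghost V A) : ghost V A :=
  if pselect (q \in Q) is left Qq then Ghost (actf q f Qq) else f.
have gactE q f H g :
    q \in Q -> ghost_fun (gact q f) H g = act H q (ghost_fun f H g).
  by rewrite /gact; case: pselect.
exists gact; split.
- move=> f; apply: ghost_eqP => H g; rewrite gactE ?rpred1 //.
  by case: (actP H) => + _ _ _; apply.
- move=> p q Qp Qq f; apply: ghost_eqP => H g; rewrite !gactE ?rpredM //.
  by case: (actP H) => _ + _ _; apply.
- move=> p q Qp Qq f; apply: ghost_eqP => H g; rewrite ghostD !gactE ?rpredD //.
  by case: (actP H) => _ _ + _; apply.
- move=> q Qq f f'; apply: ghost_eqP => H g; rewrite ghostD !gactE // ghostD.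
  by case: (actP H) => _ _ _; apply.
Qed.

Lemma mod_homD (S : pzRingType) (V V' : lmodType S) (phi : mod_hom V V') :
  {morph phi : u v / u + v}.
Proof. by move=> u v; have := mod_lin phi 1 u v; rewrite !scale1r. Qed.

Lemma mod_hom0 (S : pzRingType) (V V' : lmodType S) (phi : mod_hom V V') :
  phi 0 = 0.
Proof. by apply: (addIr (phi 0)); rewrite -mod_homD !add0r. Qed.

Lemma mod_homZ (S : pzRingType) (V V' : lmodType S) (phi : mod_hom V V') a v :
  phi (a *: v) = a *: phi v.
Proof. by have := mod_lin phi a v 0; rewrite mod_hom0 !addr0. Qed.

Variables V V' : forall H : rep, lmodType (brauer_skew R (val H)).
Hypotheses (dV : forall H, uniq_div #|gT| (V H)).
Hypotheses (dV' : forall H, uniq_div #|gT| (V' H)).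
Variable phi : forall H, mod_hom (V H) (V' H).

Fact ghost_map_proof A (f : ghost V A) :
  ((fun H g => phi H (ghost_fun f H g)) : gfun V') \in ghost_pred A.
Proof.
apply/ghostP; split=> [H n g Nn|H g Hg|H h g Ah].
- by rewrite ghost_norm // /wact mod_homZ.
- by rewrite ghost_supp // mod_hom0.
- by rewrite ghost_inv.
Qed.
Definition ghost_map_fun A (f : ghost V A) : ghost V' A :=
  Ghost (ghost_map_proof f).
Lemma ghost_map_funE A (f : ghost V A) H g :
  ghost_fun (ghost_map_fun f) H g = phi H (ghost_fun f H g).
Proof. by []. Qed.

Definition ghost_map : green_hom (ghost_mod dV) (ghost_mod dV').
Proof.
refine (@GreenHom _ _ (ghost_mod dV) (ghost_mod dV') ghost_map_fun _ _ _ _).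
- move=> A a u v; apply: ghost_eqP => H g.
  by rewrite ghostD ghostZ !ghost_map_funE ghostD ghostZ mod_homD mod_homZ.
- move=> A B s f; apply: ghost_eqP => H g; rewrite gresE !ghost_map_funE gresE.
  by case: ifP => // _; rewrite mod_hom0.
- move=> A B s f; apply/esym; apply: gind_uniq => H g; rewrite ghost_map_funE.
  have [ph phE] := additive_pack (mod_homD (phi H)).
  rewrite -phE -raddfMn gindE raddf_sum; apply: eq_bigr => x _.
  by rewrite phE.
- by move=> x A B e f; apply: ghost_eqP.
Defined.

End GhostMap.

(** * The unit *)

Section Comparison.
Variables (gT : finGroupType) (R : green gT) (T : {set {group gT}}).
Local Notation rep := {H : {group gT} | H \in T}.
Implicit Types (H : rep) (A B : {group gT}).
Hypothesis T_inj : forall H H' (x : gT), val H = (val H' :^ x)%G -> H = H'.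
Hypothesis T_surj : forall A, exists H, exists g, A = (val H :^ g^-1)%G.

Section Unit.
Variable M : green_mod R.
Hypothesis dM : forall A, uniq_div #|gT| (M A).

Local Notation mm := (gm_mackey M).
Local Notation MV := (fun H : rep => brauer_obj (val H) M).

Hypothesis dMV : forall H, uniq_div #|gT| (MV H).

Lemma bmod_pi_eqP A (u v : M A) :
  reflect (bmod_pi u = bmod_pi v) (u - v \in brauer_sub mm A).
Proof. exact: mq_eqP. Qed.

Lemma bmod_pi_eq0 A (m : M A) :
  reflect (bmod_pi m = 0) (m \in brauer_sub mm A).
Proof.
have b0 : bmod_pi (0 : M A) = 0.
  by apply: (addIr (bmod_pi (0 : M A))); rewrite -bmod_piD !add0r.
rewrite -{2}[m]subr0 -b0; exact: bmod_pi_eqP.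
Qed.

Lemma wact_bmod_pi A n (m : M A) :
  wact n (bmod_pi m : brauer_obj A M) = bmod_pi (wcnj mm (coset A n) m).
Proof. by rewrite /wact skew_scale_elt scale1r /= bmod_cnjE. Qed.

Lemma rscale_bmod_pi A (a : R A) (m : M A) :
  rscale a (bmod_pi m : brauer_obj A M) = bmod_pi (a *: m).
Proof. by rewrite /rscale skew_scale_elt sact1 bmod_piZ. Qed.

Fact bmod_pi_additive A :
  {f : {additive M A -> brauer_obj A M} | f =1 @bmod_pi _ R M A}.
Proof. exact/additive_pack/bmod_piD. Qed.

Fact ghost_unit_proof A (m : M A) :
  ((fun H g => bmod_pi (mark mm m (val H) g)) : gfun MV) \in ghost_pred A.
Proof.
apply/ghostP; split=> [H n g Nn|H g Hg|H h g Ah].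
- by rewrite mark_norm // wact_bmod_pi.
- by rewrite mark0 //; apply/bmod_pi_eq0; exact: rpred0.
- by rewrite mark_in.
Qed.
Definition ghost_unit_fun A (m : M A) : ghost MV A :=
  Ghost (ghost_unit_proof m).
Lemma ghost_unit_funE A (m : M A) H g :
  ghost_fun (ghost_unit_fun m) H g = bmod_pi (mark mm m (val H) g).
Proof. by []. Qed.

Definition ghost_unit : green_hom M (ghost_mod dMV).
Proof.
refine (@GreenHom _ _ M (ghost_mod dMV) ghost_unit_fun _ _ _ _).
- move=> A a u v; apply: ghost_eqP => H g.
  rewrite ghostD ghostZ !ghost_unit_funE rscale_bmod_pi -mark_modZ.
  rewrite -[RHS]bmod_piD.
  by congr bmod_pi; rewrite /mark !raddfD.
- move=> A B s m; apply: ghost_eqP => H g.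
  rewrite gresE !ghost_unit_funE mark_res; case: ifP => // _.
  by apply/bmod_pi_eq0; exact: rpred0.
- move=> A B s m; apply/esym; apply: gind_uniq => H g.
  rewrite ghost_unit_funE; apply: (gfun_eqMn dMV (card_dvd (val H))).
  have [p pE] := bmod_pi_additive (val H).
  have /bmod_pi_eq0 := mark_ind mm s m (val H) g.
  rewrite -!pE raddfMn raddfB raddfMn raddf_sum mulrnBl => /eqP.
  rewrite subr_eq0 => /eqP ->; congr (_ *+ _); apply: eq_bigr => x _.
  by rewrite pE.
- move=> x A B e m; apply: ghost_eqP => H g.
  by rewrite gcnjE !ghost_unit_funE mark_cnj.
Defined.

(** By induction on the order of [A] all proper restrictions of [m] vanish, and
    its component at [A] says that [m] is zero in the Brauer quotient. *)
Lemma ghost_unit_inj A (m : M A) : ghost_unit_fun m = 0 -> m = 0.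
Proof.
have [n] := ubnP #|A|; elim: n A m => // n IH A m An m0.
have [H [g AE]] := T_surj A.
apply: (@brauer_sub_res_eq0 _ _ mm _ A m (card_dvd A) (dM A)) => [|K s pK];
  last first.
  apply: IH; first by rewrite -ltnS (leq_trans _ An) // ltnS proper_card.
  by have := gh_res ghost_unit s m; rewrite /= m0 raddf0.
have e : val H = (A :^ g^-1^-1)%G.
  by rewrite AE; apply: val_inj; rewrite /= -conjsgM mulgV conjsg1.
have := congr1 (fun f => ghost_fun f H g) m0.
rewrite /= (markE _ _ _ e) (tresE _ (subxx _)) res_id => /bmod_pi_eq0 mH.
have e' : A = (A :^ (g * g^-1)^-1)%G.
  by apply: val_inj; rewrite /= mulgV invg1 conjsg1.
have -> : m = cnj mm AE (cnj mm e m).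
  by rewrite (cnj_comp mm _ _ e') cnj_id // mulgV.
move: (cnj mm e m) mH; apply: brauer_sub_map => K s y pK.
have pK' : (K :^ g^-1)%G \proper A by rewrite (congr1 val AE) properJ.
rewrite (cnj_ind mm s (proper_sub pK') erefl); exact: brauer_sub_ind.
Qed.

(** A preimage of the component at [A] alone leaves an error that is induced
    from proper subgroups, where the induction hypothesis applies. *)
Lemma ghost_unit_surj A (v : ghost MV A) : exists m, ghost_unit_fun m = v.
Proof.
have [n] := ubnP #|A|; elim: n A v => // n IH A v An.
have [H [g AE]] := T_surj A.
have [u uE] : exists u : M (val H), ghost_fun v H g = bmod_pi u.
  exact: bmod_piP.
pose m0 := cnj mm AE u; pose w := v - ghost_unit_fun m0.
have : w \in brauer_sub (ghost_mackey dMV) A.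
  apply/(ghost_brauer_sub dMV T_inj _ AE); rewrite ghostB ghost_unit_funE.
  by rewrite mark_cnj mulVg mark_id uE subrr.
case/brauer_subP=> y wE.
have yP (K : {K : {group gT} | K \proper A}) : exists m, ghost_unit_fun m = y K.
  by apply: IH; rewrite -ltnS (leq_trans _ An) // ltnS proper_card // (valP K).
pose z K := sval (cid (yP K)).
have zE K : ghost_unit_fun (z K) = y K by rewrite /z; case: cid.
have [f fE] : {f : {additive M A -> ghost MV A} | f =1 @ghost_unit_fun A}.
  apply: additive_pack => a b.
  by have := gh_lin ghost_unit A 1 a b; rewrite !scale1r.
exists (m0 + \sum_(K : {K : {group gT} | K \proper A})
               ind mm (proper_sub (valP K)) (z K)).
rewrite -fE raddfD raddf_sum fE addrC -[v](subrK (ghost_unit_fun m0)) -/w wE.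
congr (_ + _); apply: eq_bigr => K _; rewrite fE -zE.
exact: (gh_ind ghost_unit).
Qed.

Lemma ghost_unit_iso :
  is_iso (ghost_unit : @hom (green_Mack R) M (ghost_mod dMV)).
Proof.
apply: green_hom_iso => A.
exists (fun v => sval (cid (ghost_unit_surj v))) => [m|v]; last by case: cid.
case: cid => m' /= m'E; apply/eqP; rewrite -subr_eq0; apply/eqP/ghost_unit_inj.
have := gh_lin ghost_unit A (-1) m m'.
by rewrite !scaleN1r /= m'E addNr addrC.
Qed.

End Unit.

(** * The counit *)

Section Counit.
Variable V : forall H : rep, lmodType (brauer_skew R (val H)).
Hypothesis dV : forall H, uniq_div #|gT| (V H).
Variable H : rep.

Local Notation F := (ghost_mod dV).

Definition ghost_counit_fun (x : brauer_obj (val H) F) : V H :=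
  ghost_fun (sval (cid (bmod_piP x)) : ghost V (val H)) H 1%g.

(** The case [g = 1] of [ghost_brauer_sub]: the counit is well defined and
    injective. *)
Lemma ghost_brauer_sub1 (f : ghost V (val H)) :
  reflect (ghost_fun f H 1%g = 0) (f \in brauer_sub (gm_mackey F) (val H)).
Proof.
apply: (ghost_brauer_sub dV T_inj).
by apply: val_inj; rewrite /= invg1 conjsg1.
Qed.

Lemma ghost_counitE (f : ghost V (val H)) :
  ghost_counit_fun (bmod_pi (f : F (val H))) = ghost_fun f H 1%g.
Proof.
rewrite /ghost_counit_fun; case: cid => f' /= ff'.
apply/esym/eqP; rewrite -subr_eq0 -ghostB; apply/eqP/ghost_brauer_sub1.
by apply/bmod_pi_eqP.
Qed.

Lemma skew_sum_elt (W : finGroupType) (S : pzRingType) (al : ring_action W S)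
  (a : skew al) : a = \sum_w skew_elt al (skew_fun a w) w.
Proof.
apply: skew_funP => x.
have -> : skew_fun (\sum_w skew_elt al (skew_fun a w) w) x =
    \sum_w skew_fun (skew_elt al (skew_fun a w) w) x.
  by elim/big_rec2: _ => [|w u v _ <-]; [exact: ffunE | exact: ffunE].
rewrite (bigD1 x) //= big1 => [|w wx]; rewrite skew_fun_elt.
  by rewrite eqxx addr0.
by rewrite eq_sym (negPf wx).
Qed.

Lemma ghost_counit_lin : linear ghost_counit_fun.
Proof.
have D : {morph ghost_counit_fun : x y / x + y}.
  move=> x y; case: (bmod_piP x) (bmod_piP y) => [u ->] [v ->].
  by rewrite -[bmod_pi u + _]bmod_piD !ghost_counitE ghostD.
have [c cE] := additive_pack D.
have Z (a : brauer_ring R (val H)) (w : coset_of (val H)) x :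
    ghost_counit_fun (skew_elt (brauer_ract R (val H)) a w *: x) =
    skew_elt (brauer_ract R (val H)) a w *: ghost_counit_fun x.
  case: (bring_piP a) (bmod_piP x) => [r ->] [f ->].
  rewrite skew_scale_elt /= bmod_cnjE -bmod_piZ !ghost_counitE ghostZ mark_id.
  rewrite gcnjE mulg1 -[(repr w)^-1%g]mul1g ghost_norm ?repr_coset_norm //.
  by rewrite /rscale /wact scalerA skew_eltM ract_one mulr1 mul1g coset_reprK.
move=> a u v; rewrite D; congr (_ + _).
rewrite (skew_sum_elt a) !scaler_suml -cE raddf_sum; apply: eq_bigr => w _.
by rewrite !cE Z.
Qed.

Definition ghost_counit : mod_hom (brauer_obj (val H) F) (V H) :=
  ModHom ghost_counit_lin.

(** The family concentrated at [H]; [g] normalizes [H] exactly when [H] is the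
    subgroup [g H g^-1]. *)
Lemma ghost_extend (v : V H) :
  exists f : ghost V (val H), ghost_fun f H 1%g = v.
Proof.
pose w : gfun V := fun H' g =>
  if pselect (H = H') is left e then
    if g \in 'N(val H')%g then wact g^-1%g (ecast K (V K) e v) else 0
  else 0.
have wP : w \in ghost_pred (val H).
  apply/ghostP; split=> [H' n g Nn|H' g Hg|H' h g Hh]; rewrite /w.
  - case: pselect => [e|_]; last by rewrite raddf0.
    rewrite groupMr ?groupV //; case: ifP => Ng; last by rewrite raddf0.
    by rewrite invMg invgK wactM // groupV.
  - case: pselect => // e; case: ifP => // Ng; case/negP: Hg.
    by rewrite e (normP Ng).
  - case: pselect => // e; have {}Hh : h \in val H' by rewrite -e.
    have Nh := subsetP (normG (val H')) h Hh.
    rewrite groupMl //; case: ifP => // Ng.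
    by rewrite invMg wactM ?groupV // [X in wact _ X]wact_in ?groupV.
exists (Ghost wP); rewrite /= /w; case: pselect => // e.
by rewrite group1 invg1 (Prop_irrelevance e erefl) wact_in.
Qed.

Lemma ghost_counit_iso :
  is_iso (ghost_counit : @hom (Mod _) (brauer_obj (val H) F) (V H)).
Proof.
apply: mod_hom_iso.
have surj v : exists x, ghost_counit_fun x = v.
  have [f fv] := ghost_extend v; exists (bmod_pi (f : F (val H))).
  by rewrite ghost_counitE.
exists (fun v => sval (cid (surj v))) => [x|v]; last by case: cid.
case: cid => y /=; case: (bmod_piP x) (bmod_piP y) => [f ->] [f' ->].
rewrite !ghost_counitE => ff'.
have e : (f' - f : F (val H)) \in brauer_sub (gm_mackey F) (val H).
  by apply/ghost_brauer_sub1; rewrite ghostB ff' subrr.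
exact: (elimT (bmod_pi_eqP _ _) e).
Qed.

End Counit.

Lemma ghost_counit_natural
    (V V' : forall H : rep, lmodType (brauer_skew R (val H)))
    (dV : forall H, uniq_div #|gT| (V H))
    (dV' : forall H, uniq_div #|gT| (V' H))
    (phi : forall H, mod_hom (V H) (V' H)) H :
  @comp (Mod _) _ _ _ (ghost_counit dV' H)
    (brauer_map (val H) (ghost_map dV dV' phi)) =
  @comp (Mod _) _ _ _ (phi H) (ghost_counit dV H).
Proof.
apply: mod_hom_eq => x; case: (bmod_piP x) => u ->; rewrite /= brauer_funE.
by rewrite [LHS]ghost_counitE [in RHS]ghost_counitE.
Qed.

End Comparison.

(** * The equivalence *)

Section Reps.
Variables (gT : finGroupType) (T : {set {group gT}}).
Hypothesis hT : class_reps T.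
Local Notation rep := {H : {group gT} | H \in T}.

Fact orbit_in_orbits (A : {group gT}) : orbit 'JG%act [set: gT] A \in
  [set orbit 'JG%act [set: gT] H | H : {group gT}].
Proof. by apply/imsetP; exists A. Qed.

Lemma class_reps_surj (A : {group gT}) :
  exists H : rep, exists g, A = (val H :^ g^-1)%G.
Proof.
case/and3P: hT => _ _ /forall_inP/(_ (orbit 'JG%act [set: gT] A)).
case/(_ (orbit_in_orbits _))/cards1P => H HE.
have : H \in T :&: orbit 'JG%act [set: gT] A by rewrite HE set11.
case/setIP=> TH /orbitP[g _ gE]; exists (exist _ H TH), g; apply: val_inj.
by rewrite /= -gE /= conjsgK.
Qed.

Lemma class_reps_inj (H H' : rep) (x : gT) : val H = (val H' :^ x)%G -> H = H'.
Proof.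
move=> HE; case/and3P: hT => _ _ /forall_inP.
move/(_ (orbit 'JG%act [set: gT] (val H'))).
case/(_ (orbit_in_orbits _))/cards1P => K KE.
have inK (L : rep) : val L \in orbit 'JG%act [set: gT] (val H') -> val L = K.
  by move=> HL; apply/set1P; rewrite -KE inE HL (valP L).
apply: val_inj; transitivity K; last by apply/esym/inK; exact: orbit_refl.
by apply: inK; rewrite HE; exact: (mem_orbit 'JG%act _ (in_setT x)).
Qed.

End Reps.

Section Inverse.
Variables (gT : finGroupType) (R : green gT) (Q : subringClosed rat).
Hypothesis hQ : (#|gT|%:R : rat)^-1 \in Q.
Variable T : {set {group gT}}.
Local Notation rep := {H : {group gT} | H \in T}.
Local Notation target :=
  (prod_cat (fun H : rep => QMod Q (brauer_skew R (val H)))).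

Lemma Qlocal_div (V : zmodType) : Qlocal Q V -> uniq_div #|gT| V.
Proof.
by apply: Qlocal_uniq_div hQ; rewrite -cardsT; exact: (cardG_gt0 [set: gT]%G).
Qed.

Lemma target_div (X : target) (H : rep) : uniq_div #|gT| (sval (X H)).
Proof. exact: Qlocal_div (svalP (X H)). Qed.

Definition ghost_obj (X : target) : QMack R Q :=
  exist (fun M : green_mod R => forall A, Qlocal Q (M A))
    (ghost_mod (target_div X))
    (fun A => ghost_Qlocal A (fun H => svalP (X H))).

Definition ghostF : functor target (QMack R Q).
Proof.
refine (@Functor target (QMack R Q) ghost_obj
  (fun X Y f => ghost_map (target_div X) (target_div Y) f) _ _).
- by move=> X; apply: green_hom_eq => A f; apply: ghost_eqP.
- by move=> X Y Z g f; apply: green_hom_eq => A m; apply: ghost_eqP.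
Defined.

End Inverse.

Theorem theorem1 (gT : finGroupType) (R : green gT)
    (Q : subringClosed rat) (hQ : (#|gT|%:R : rat)^-1 \in Q)
    (T : {set {group gT}}) (hT : class_reps T) :
  is_equivalence (BrQ R T Q).
Proof.
exists (ghostF R hQ T); split.
  apply: nat_iso_sym.
  exists (fun M : QMack R Q => ghost_unit (M := sval M)
    (target_div hQ (BrQ R T Q M))).
  split=> [M N f|M].
    apply: green_hom_eq => A m; apply: ghost_eqP => H g /=.
    by rewrite brauer_funE mark_gh.
  have [f [fK Kf]] := ghost_unit_iso (class_reps_inj hT) (class_reps_surj hT)
    (fun A => Qlocal_div hQ (svalP M A))
    (target_div hQ (BrQ R T Q M)).
  by exists f.
exists (fun X H => ghost_counit (class_reps_inj hT) (target_div hQ X) H).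
split=> [X Y f|X].
  apply: functional_extensionality_dep => H.
  exact: (@ghost_counit_natural _ _ _ (class_reps_inj hT) _ _
            (target_div hQ X) (target_div hQ Y) f H).
apply: prod_cat_iso => H.
have [f [fK Kf]] := ghost_counit_iso (class_reps_inj hT) (target_div hQ X) H.
by exists f.
Qed.
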